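(* Let $k\geq 2$ be an integer. If $\mathcal{H}$ is a $3$-uniform hypergraph on $n$ vertices which contains no torus-like topological cycle of length at most $6k$, then $\mathcal{H}$ has at most $n^{2+2/(k-1)+o(1)}$ edges (where $o(1)\to0$ as $n\to\infty$ for fixed $k$).
   Context: A $3$-uniform hypergraph is identified with the simplicial complex formed by its edges and their subsets. A topological cycle is a $3$-uniform hypergraph which is a triangulation of the cylinder $S^1\times[0,1]$ or of the Möbius strip in which every vertex lies on the boundary; its length is its number of edges. It is torus-like if it has an even number of edges and triangulates the cylinder, or an odd number of edges and triangulates the Möbius strip. ''$\mathcal{H}$ contains'' such a cycle means some subhypergraph of $\mathcal{H}$ is one. *)

(* Defs.v *)
From HB Require Import structures.
From mathcomp Require Import all_boot all_order all_algebra.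
From mathcomp Require Import all_classical all_reals all_analysis.

Set Implicit Arguments.
Unset Strict Implicit.
Unset Printing Implicit Defensive.

Import Order.TTheory GRing.Theory Num.Theory.
Import numFieldNormedType.Exports.

Local Open Scope classical_set_scope.
Local Open Scope ring_scope.

(* A and B carry the subspace topologies; the values of f outside A and of g
   outside B are irrelevant. *)
Definition homeomorphism (T U : topologicalType) (A : set T) (B : set U)
    (f : T -> U) : Prop :=
  [/\ set_bij A B f,
      {within A, continuous f} &
      exists2 g : U -> T, {within B, continuous g} & {in A, cancel f g}].

Section Surfaces.
Variable R : realType.

Definition circle : set (R * R) := [set p | p.1 ^+ 2 + p.2 ^+ 2 = 1].

Definition cylinder : set ((R * R) * R) := circle `*` `[0, 1].

Definition cylinder_boundary : set ((R * R) * R) := circle `*` [set 0; 1].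

(* The usual parametrization in 3-space: a segment of half-length 1/2, centred
   on the unit circle, makes half a turn while its centre, at angle t, goes
   once around the circle; s in [-1, 1] is the position on the segment. *)
Definition mobius_param (p : R * R) : (R * R) * R :=
  let: (t, s) := p in
  (((1 + s / 2 * cos (t / 2)) * cos t, (1 + s / 2 * cos (t / 2)) * sin t),
   s / 2 * sin (t / 2)).

Definition mobius : set ((R * R) * R) := mobius_param @` (setT `*` `[-1, 1]).

Definition mobius_boundary : set ((R * R) * R) :=
  mobius_param @` (setT `*` [set -1; 1]).

End Surfaces.

(* A hypergraph on the vertex set V is its set of edges. *)
Definition uniform3 (V : finType) (H : {set {set V}}) : Prop :=
  forall e : {set V}, e \in H -> #|e| = 3%N.

Section TopologicalCycles.
Variables (R : realType) (V : finType).
Implicit Type C : {set {set V}}.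

(* Geometric realization, in barycentric coordinates, of the simplicial
   complex formed by the edges of C and their subsets. Elements of V that lie
   in no edge of C contribute nothing. *)
Definition realization C : set {ptws V -> R} :=
  [set x | [/\ forall v, 0 <= x v,
               \sum_v x v = 1 &
               exists2 e, e \in C & forall v, v \notin e -> x v = 0]].

Definition vertex_point (v : V) : {ptws V -> R} := fun u => (u == v)%:R.

(* C triangulates the surface S, with all its vertices on the boundary dS. *)
Definition boundary_triangulation C (S dS : set ((R * R) * R)) : Prop :=
  uniform3 C /\
  exists2 h : {ptws V -> R} -> (R * R) * R,
    homeomorphism (realization C) S h &
    forall (e : {set V}) (v : V), e \in C -> v \in e -> dS (h (vertex_point v)).

Definition cylinder_cycle C : Prop :=
  boundary_triangulation C (@cylinder R) (@cylinder_boundary R).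

Definition mobius_cycle C : Prop :=
  boundary_triangulation C (@mobius R) (@mobius_boundary R).

Definition torus_like_cycle C : Prop :=
  (cylinder_cycle C /\ ~~ odd #|C|) \/ (mobius_cycle C /\ odd #|C|).

End TopologicalCycles.

(* Main.v *)
(* Prune the hypergraph so that every pair contained in an edge has codegree at least d.
   Join two ordered pairs (a, b), (c, e) of vertices when a b e and b e c are edges. A closed
   walk of even length N = 2 j in this graph whose pairs are pairwise disjoint gives a ring of
   N quadrilaterals, each cut along a diagonal: a cylinder with 2 N triangles.

   Let S be the normalized symmetric kernel of the graph and t_j the trace of S^(2j).
   Cauchy-Schwarz bounds the square of the weight of the closed walks with a conflict between
   two given positions by (4 / d) t_(j-1) t_j. As t_1 <= n^2 and t_m >= 1, some j <= m has
   t_(j-1) <= n^(2/(m-1)) t_j, and then conflict-free closed walks of length 2 j exist once d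
   exceeds a constant times n^(2/(m-1)). With m = k + 1 the cycle has 4 j <= 4 (k + 1) <= 6 k
   edges, and d of order n^(2/(k-1)) is more than enough for large n, so that the error term
   is only needed for finitely many n. *)
Require Import Defs.
From HB Require Import structures.
From mathcomp Require Import all_boot all_order all_algebra.
From mathcomp Require Import all_classical all_reals all_analysis.
From mathcomp Require Import ring lra zify.
Import Order.TTheory GRing.Theory Num.Theory.
Import numFieldNormedType.Exports.
Local Open Scope classical_set_scope.
Local Open Scope ring_scope.

Set Implicit Arguments.
Unset Strict Implicit.
Unset Printing Implicit Defensive.

(** * Weighted closed walks *)

(** Assuming only [c i ^+ 2 <= p i * q i] avoids square roots of weights. After expanding into
    double sums, the arithmetic-geometric mean inequality bounds [2 * (c i * c j)]. *)
Lemma Cauchy_Schwarz_sum (R : realType) (I : finType) (c p q : I -> R) :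
  (forall i, 0 <= c i) -> (forall i, 0 <= p i) -> (forall i, 0 <= q i) ->
  (forall i, c i ^+ 2 <= p i * q i) ->
  (\sum_i c i) ^+ 2 <= (\sum_i p i) * (\sum_i q i).
Proof.
move=> c0 p0 q0 cpq.
have key i j : 2 * (c i * c j) <= p i * q j + p j * q i.
  rewrite -ler_sqr ?nnegrE; last 2 first.
  - by rewrite !mulr_ge0.
  - by rewrite addr_ge0 ?mulr_ge0.
  have : c i ^+ 2 * c j ^+ 2 <= (p i * q i) * (p j * q j).
    by rewrite ler_pM ?sqr_ge0.
  have := sqr_ge0 (p i * q j - p j * q i).
  set A := p i; set B := q j; set C := p j; set D := q i; nra.
have E1 : (\sum_i c i) ^+ 2 = \sum_i \sum_j c i * c j.
  by rewrite expr2 mulr_suml; apply: eq_bigr => i _; rewrite mulr_sumr.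
have E2 : (\sum_i p i) * (\sum_i q i) = \sum_i \sum_j p i * q j.
  by rewrite mulr_suml; apply: eq_bigr => i _; rewrite mulr_sumr.
have E3 : (\sum_i p i) * (\sum_i q i) = \sum_i \sum_j p j * q i.
  by rewrite E2 exchange_big.
have : \sum_i \sum_j 2 * (c i * c j) <= \sum_i \sum_j (p i * q j + p j * q i).
  by do 2 apply: ler_sum => ? _; exact: key.
under eq_bigr do rewrite -mulr_sumr.
under [X in _ <= X]eq_bigr do rewrite big_split.
rewrite -mulr_sumr big_split /= -E1 -E2 -E3; lra.
Qed.

Section Walks.
Variables (R : realType) (U : finType) (S : U -> U -> R).
Hypothesis S_ge0 : forall x y, 0 <= S x y.
Hypothesis S_sym : forall x y, S x y = S y x.

(** The entries of the [n]-th power of the matrix [S]. *)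
Fixpoint walks n x y : R :=
  if n is n'.+1 then \sum_z S x z * walks n' z y else (x == y)%:R.

(** Integrates [Phi] over the weighted walks of [n] steps from [x]; the sequence passed to [Phi]
    lists the vertices after [x]. *)
Fixpoint walk_sum n x (Phi : seq U -> R) : R :=
  if n is n'.+1 then \sum_z S x z * walk_sum n' z (fun s => Phi (z :: s))
  else Phi [::].

(** The squared Frobenius norm of the [j]-th power; by symmetry of [S] this is the total weight of
    the closed walks of length [2 j]. *)
Definition moment j : R := \sum_x \sum_y walks j x y ^+ 2.

Lemma walks_ge0 n x y : 0 <= walks n x y.
Proof.
by elim: n x => [|n IH] x /=; rewrite ?ler0n// sumr_ge0// => z _; rewrite mulr_ge0.
Qed.

Lemma sum_delta (f : U -> R) x : \sum_y (x == y)%:R * f y = f x.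
Proof.
rewrite (bigD1 x)//= eqxx mul1r big1 ?addr0// => y /negbTE yx.
by rewrite eq_sym yx mul0r.
Qed.

Lemma walksD m n x y : walks (m + n) x y = \sum_z walks m x z * walks n z y.
Proof.
elim: m x => [|m IH] x /=; first by rewrite sum_delta.
under eq_bigr do rewrite IH mulr_sumr.
rewrite exchange_big; apply: eq_bigr => z _ /=.
by rewrite mulr_suml; apply: eq_bigr => w _; rewrite mulrA.
Qed.

Lemma walks1 x y : walks 1 x y = S x y.
Proof. by rewrite /= (bigD1 y)//= eqxx mulr1 big1 ?addr0// => z /negbTE->; rewrite mulr0. Qed.

Lemma walks_sym n x y : walks n x y = walks n y x.
Proof.
elim: n x y => [|n IH] x y; first by rewrite /= eq_sym.
rewrite -[in RHS]addn1 walksD [LHS]/=; apply: eq_bigr => z _.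
by rewrite walks1 S_sym IH mulrC.
Qed.

Lemma moment_trace j : moment j = \sum_x walks (j + j) x x.
Proof.
apply: eq_bigr => x _; rewrite walksD; apply: eq_bigr => y _.
by rewrite expr2 [in X in _ = _ * X]walks_sym.
Qed.

Lemma eq_walk_sum n x Phi Psi :
  (forall s, size s = n -> Phi s = Psi s) -> walk_sum n x Phi = walk_sum n x Psi.
Proof.
elim: n x Phi Psi => [|n IH] x Phi Psi E /=; first exact: E.
by apply: eq_bigr => z _; congr *%R; apply: IH => s sn; rewrite E//= sn.
Qed.

Lemma walk_sum_cat m n x Phi : walk_sum (m + n) x Phi =
  walk_sum m x (fun s => walk_sum n (last x s) (fun s' => Phi (s ++ s'))).
Proof. by elim: m x Phi => [|m IH] x Phi //=; apply: eq_bigr => z _; rewrite IH. Qed.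

Lemma walk_sum_last n x g :
  walk_sum n x (fun s => g (last x s)) = \sum_y walks n x y * g y.
Proof.
elim: n x => [|n IH] x /=; first by rewrite sum_delta.
under eq_bigr do rewrite IH mulr_sumr.
rewrite exchange_big; apply: eq_bigr => z _ /=.
by rewrite mulr_suml; apply: eq_bigr => w _; rewrite mulrA.
Qed.

Lemma walk_sumB n x Phi Psi :
  walk_sum n x (fun s => Phi s - Psi s) = walk_sum n x Phi - walk_sum n x Psi.
Proof.
elim: n x Phi Psi => [|n IH] x Phi Psi //=.
by rewrite -sumrB; apply: eq_bigr => z _; rewrite IH mulrBr.
Qed.

Lemma walk_sum_sum (I : finType) (P : pred I) n x (Phi : I -> seq U -> R) :
  walk_sum n x (fun s => \sum_(i | P i) Phi i s) = \sum_(i | P i) walk_sum n x (Phi i).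
Proof.
elim: n x Phi => [|n IH] x Phi //=.
by rewrite exchange_big; apply: eq_bigr => z _; rewrite IH mulr_sumr.
Qed.

(** [Phi] may be negative, but as [S] is nonnegative a positive total forces a positive summand at
    every step. This extracts an actual walk from a weighted count. *)
Lemma walk_sum_gt0 n x Phi : 0 < walk_sum n x Phi ->
  exists s, [/\ size s = n, path (fun y z => 0 < S y z) x s & 0 < Phi s].
Proof.
elim: n x Phi => [|n IH] x Phi /= => [Phi0|]; first by exists [::].
move=> pos; have [z Sz] : exists z, 0 < S x z * walk_sum n z (fun s => Phi (z :: s)).
  apply: contrapT => /forallNP N; move: pos; apply/negP; rewrite -leNgt.
  by apply: sumr_le0 => z _; rewrite leNgt; apply/negP/N.
have Sxz : 0 < S x z.
  by rewrite lt_neqAle S_ge0 andbT; apply: contraTneq Sz => <-; rewrite mul0r ltxx.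
move: Sz; rewrite pmulr_rgt0// => /IH[s [ss ps Ps]].
by exists (z :: s); rewrite /= ss Sxz.
Qed.

Variable conf : rel U.
Hypothesis conf_sym : symmetric conf.

(** Closed walks cut at two conflicting vertices into arcs of lengths [a] and [b]. *)
Definition conf_walks a b : R :=
  \sum_x \sum_y (conf x y)%:R * (walks a x y * walks b y x).

Lemma conf_walksC a b : conf_walks a b = conf_walks b a.
Proof.
rewrite /conf_walks exchange_big; apply: eq_bigr => y _; apply: eq_bigr => x _.
by rewrite conf_sym [walks a x y * _]mulrC.
Qed.

Definition closed_conf i i' x (s : seq U) : R :=
  (last x s == x)%:R * (conf (nth x (x :: s) i) (nth x (x :: s) i'))%:R.

Lemma nth_last_cat x (s1 s2 : seq U) : nth x (x :: s1 ++ s2) (size s1) = last x s1.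
Proof.
by rewrite -cat_cons nth_cat /= ltnS leqnn (last_nth x).
Qed.

(** The walk is cut at positions [i] and [i']. As it is closed, its last and first segments join
    into one arc of length [n - (i' - i)]. *)
Lemma sum_closed_conf n i i' : (i <= i')%N -> (i' <= n)%N ->
  \sum_x walk_sum n x (closed_conf i i' x) = conf_walks (i' - i) (n - (i' - i)).
Proof.
move=> ii' i'n.
have En : n = (i + ((i' - i) + (n - i')))%N by lia.
have step x : walk_sum n x (closed_conf i i' x) =
    \sum_y \sum_z walks i x y * (conf y z)%:R * walks (i' - i) y z * walks (n - i') z x.
  rewrite {1}En walk_sum_cat.
  pose g y := \sum_z walks (i' - i) y z * ((conf y z)%:R * walks (n - i') z x).
  rewrite (@eq_walk_sum _ _ _ (fun s => g (last x s))); last first.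
    move=> s ss; rewrite walk_sum_cat.
    set y := last x s.
    rewrite (@eq_walk_sum _ _ _ (fun s' => (conf y (last y s'))%:R * walks (n - i') (last y s') x)).
      by rewrite (walk_sum_last (i' - i) y (fun z => (conf y z)%:R * walks (n - i') z x)).
    move=> s' ss'; set z := last y s'.
    rewrite (@eq_walk_sum _ _ _ (fun s'' => (fun w => (conf y z)%:R * (w == x)%:R) (last z s''))).
      rewrite (walk_sum_last (n - i') z (fun w => (conf y z)%:R * (w == x)%:R)).
      transitivity ((conf y z)%:R * \sum_w (x == w)%:R * walks (n - i') z w).
        by rewrite mulr_sumr; apply: eq_bigr => w _; rewrite [w == x]eq_sym; ring.
      by rewrite sum_delta.
    move=> s'' ss''; rewrite /closed_conf !last_cat -/y -/z mulrC; congr (_%:R * _).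
    rewrite -{1}ss nth_last_cat -/y; congr (conf _ _ : nat).
    rewrite catA (_ : i' = size (s ++ s')); last by rewrite size_cat ss ss'; lia.
    by rewrite nth_last_cat last_cat.
  rewrite walk_sum_last; apply: eq_bigr => y _; rewrite /g mulr_sumr.
  by apply: eq_bigr => z _; ring.
under eq_bigr do rewrite step.
rewrite exchange_big; apply: eq_bigr => y _.
rewrite exchange_big; apply: eq_bigr => z _ /=.
rewrite (_ : (n - (i' - i) = (n - i') + i)%N); last by lia.
rewrite walksD !mulr_sumr; apply: eq_bigr => x _; ring.
Qed.

(** [v] is an eigenvector for the eigenvalue [1], so where [v x] is positive the numbers
    [S x y * v y / v x] are transition probabilities from [x]. In these terms [S_v_conf] says that a
    step conflicts with a given vertex with probability at most [delta]. *)
Variables (v : U -> R) (delta : R).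
Hypothesis delta_ge0 : 0 <= delta.
Hypothesis v_ge0 : forall x, 0 <= v x.
Hypothesis S_v_gt0 : forall x y, 0 < S x y -> 0 < v x.
Hypothesis S_v : forall x, \sum_y S x y * v y = v x.
Hypothesis S_v_conf : forall x z, \sum_(y | conf y z) S x y * v y <= delta * v x.

Lemma walks_v n x : \sum_y walks n x y * v y = v x.
Proof.
elim: n x => [|n IH] x /=; first by rewrite sum_delta.
under eq_bigr do rewrite mulr_suml.
rewrite exchange_big -[RHS]S_v; apply: eq_bigr => z _ /=.
by rewrite -(IH z) mulr_sumr; apply: eq_bigr => y _; rewrite mulrA.
Qed.

(** The [j]-th power also fixes [v], so its Frobenius norm is at least [1]: apply Cauchy-Schwarz to
    its quadratic form at [v]. *)
Lemma moment_ge1 j : (exists x, 0 < v x) -> 1 <= moment j.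
Proof.
move=> [x0 vx0]; set Q := \sum_x v x ^+ 2.
have Q0 : 0 < Q.
  rewrite /Q (bigD1 x0)//= ltr_wpDr ?exprn_gt0//.
  by apply: sumr_ge0 => x _; rewrite sqr_ge0.
have := @Cauchy_Schwarz_sum R (U * U)%type
  (fun p => v p.1 * walks j p.1 p.2 * v p.2)
  (fun p => walks j p.1 p.2 ^+ 2) (fun p => (v p.1 * v p.2) ^+ 2).
rewrite -(pair_bigA _ (fun x y => v x * walks j x y * v y)) /=.
rewrite -(pair_bigA _ (fun x y => walks j x y ^+ 2)) /=.
rewrite -(pair_bigA _ (fun x y => (v x * v y) ^+ 2)) /= -/(moment j).
have -> : \sum_x \sum_y v x * walks j x y * v y = Q.
  apply: eq_bigr => x _; rewrite expr2 -[in RHS](walks_v j x) mulr_sumr.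
  by apply: eq_bigr => y _; rewrite walks_v mulrA.
have -> : \sum_x \sum_y (v x * v y) ^+ 2 = Q ^+ 2.
  rewrite expr2 mulr_suml; apply: eq_bigr => x _.
  by rewrite mulr_sumr; apply: eq_bigr => y _; rewrite exprMn.
move=> H; have : 1 * Q ^+ 2 <= moment j * Q ^+ 2.
  rewrite mul1r; apply: H => [p|p|p|p]; rewrite ?sqr_ge0 ?mulr_ge0 ?walks_ge0//.
  by rewrite -exprMn [X in _ <= X](_ : _ = (v p.1 * walks j p.1 p.2 * v p.2) ^+ 2)//; ring.
by rewrite ler_pM2r// exprn_gt0.
Qed.

Lemma S_v_le x y : S x y * v y <= v x.
Proof.
rewrite -[X in _ <= X]S_v (bigD1 y)//= lerDl; apply: sumr_ge0 => z _; exact: mulr_ge0.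
Qed.

(** Each row contributes at most [1]: by symmetry [S x y * v x <= v y], so
    [S x y ^+ 2 * v x <= S x y * v y], and the right-hand sides sum to [v x]. *)
Lemma moment1_le : moment 1 <= #|U|%:R.
Proof.
rewrite -sum1_card natr_sum; apply: ler_sum => x _.
have [vx|vx] := eqVneq (v x) 0.
  rewrite big1// => y _; rewrite walks1.
  case: (ltgtP 0 (S x y)) (S_ge0 x y) => // [/S_v_gt0|<-]; first by rewrite vx ltxx.
  by rewrite expr0n.
have vx0 : 0 < v x by rewrite lt_neqAle eq_sym vx v_ge0.
rewrite -(ler_pM2r vx0) mul1r mulr_suml -[X in _ <= X]S_v.
apply: ler_sum => y _; rewrite walks1 expr2 -mulrA ler_wpM2l//.
by rewrite S_sym S_v_le.
Qed.

(* The conflicting closed walks are split as [x] -> [x2] -> ... -> [z] -> ... -> [x]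
   with the conflict between [x] and a vertex of the walk from [x2] to [z]; the walk
   from [z] back to [x] has length [j], the one from [x2] to [z] length [j - 1]. *)
Lemma conf_walks_sqr_le j a : (0 < a <= j)%N ->
  conf_walks a (j + j - a) ^+ 2 <= delta * moment j.-1 * moment j.
Proof.
case: a => // a /andP[_ aj].
(* The weight of the walks of length [j - 1] from [x2] to [z] whose vertex after [a] steps conflicts
   with [x]. *)
pose G x x2 z := \sum_y (conf x y)%:R * (walks a x2 y * walks (j - a.+1) y z).
have G0 x x2 z : 0 <= G x x2 z.
  by apply: sumr_ge0 => y _; rewrite !mulr_ge0 ?walks_ge0.
have GX x x2 z : G x x2 z <= walks j.-1 x2 z.
  rewrite (_ : j.-1 = a + (j - a.+1))%N; last by lia.
  rewrite walksD; apply: ler_sum => y _.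
  by case: conf; rewrite ?mul1r// mul0r mulr_ge0 ?walks_ge0.
have -> : conf_walks a.+1 (j + j - a.+1) =
    \sum_x \sum_x2 \sum_z S x x2 * G x x2 z * walks j z x.
  apply: eq_bigr => x _.
  transitivity (\sum_y \sum_x2 \sum_z
     S x x2 * ((conf x y)%:R * (walks a x2 y * walks (j - a.+1) y z)) * walks j z x).
    apply: eq_bigr => y _.
    rewrite (_ : j + j - a.+1 = (j - a.+1) + j)%N; last by lia.
    rewrite walksD /= mulr_suml mulr_sumr; apply: eq_bigr => x2 _.
    by rewrite mulr_sumr mulr_sumr; apply: eq_bigr => z _; ring.
  rewrite exchange_big; apply: eq_bigr => x2 _; rewrite exchange_big.
  apply: eq_bigr => z _ /=; rewrite /G -mulr_suml; congr *%R.
  by rewrite mulr_sumr.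
have -> : delta * moment j.-1 * moment j = moment j * (delta * moment j.-1).
  by rewrite mulrC.
(* The factor [v x2 / v x] and its inverse balance Cauchy-Schwarz: [p] can then be summed over [x2]
   by the eigenvector equation, and [q] over [x] by the conflict bound. *)
pose p x x2 z := S x x2 * (v x2 / v x) * walks j z x ^+ 2.
pose q x x2 z := S x x2 * (v x / v x2) * G x x2 z ^+ 2.
have := @Cauchy_Schwarz_sum R (U * (U * U))%type
  (fun t => S t.1 t.2.1 * G t.1 t.2.1 t.2.2 * walks j t.2.2 t.1)
  (fun t => p t.1 t.2.1 t.2.2) (fun t => q t.1 t.2.1 t.2.2).
have E f : \sum_(t : U * (U * U)) f t.1 t.2.1 t.2.2 = \sum_x \sum_x2 \sum_z f x x2 z :> R.
  under [RHS]eq_bigr => x do rewrite (pair_bigA _ (f x)).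
  by rewrite (pair_bigA _ (fun x (u : U * U) => f x u.1 u.2)).
rewrite (E (fun x x2 z => S x x2 * G x x2 z * walks j z x)) (E p) (E q).
move=> H; apply: le_trans.
  apply: H => [t|t|t|].
  - by rewrite !mulr_ge0 ?walks_ge0 ?S_ge0 ?G0.
  - by rewrite /p !mulr_ge0 ?walks_ge0 ?invr_ge0.
  - by rewrite /q !mulr_ge0 ?G0 ?invr_ge0.
  - move=> [x [x2 z]]; rewrite /p /q /=.
    case: (ltgtP 0 (S x x2)) (S_ge0 x x2) => // [Sp _|<- _]; last by rewrite !mul0r expr0n.
    have v1 : v x != 0 by rewrite gt_eqF// (S_v_gt0 Sp).
    have v2 : v x2 != 0 by rewrite gt_eqF//; move: Sp; rewrite S_sym; exact: S_v_gt0.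
    by rewrite le_eqVlt; apply/orP; left; apply/eqP; field; rewrite v1 v2.
(* This covers [w = 0] as well, where the quotient is [0] by convention. *)
have ratio (A B : R) : 0 <= A -> 0 <= B -> forall w, 0 <= w -> A <= B * w -> A / w <= B.
  move=> A0 B0 w w0 AB; have [w00|wn] := eqVneq w 0; first by rewrite w00 invr0 mulr0.
  by rewrite ler_pdivrMr// lt_neqAle eq_sym wn.
apply: ler_pM.
- by do 3 apply: sumr_ge0 => ? _; rewrite /p !mulr_ge0 ?walks_ge0 ?invr_ge0.
- by do 3 apply: sumr_ge0 => ? _; rewrite /q !mulr_ge0 ?G0 ?invr_ge0.
- rewrite /moment; apply: ler_sum => x _; rewrite exchange_big; apply: ler_sum => z _ /=.
  rewrite /p -mulr_suml walks_sym -[X in _ <= X]mul1r ler_wpM2r ?sqr_ge0//.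
  under eq_bigr do rewrite mulrA.
  rewrite -mulr_suml S_v; apply: ratio => //; by rewrite mul1r.
(* One factor [G] is bounded by the unrestricted walks; the other keeps the conflict with [x], whose
   sum over [x] yields [delta]. *)
rewrite exchange_big /moment mulr_sumr; apply: ler_sum => x2 _.
rewrite exchange_big mulr_sumr; apply: ler_sum => z _ /=.
have [vx2|vx2] := eqVneq (v x2) 0.
  rewrite big1 => [|x _]; last by rewrite /q vx2 invr0 !(mulr0, mul0r).
  by rewrite mulr_ge0 ?sqr_ge0.
have vx20 : 0 < v x2 by rewrite lt_neqAle eq_sym vx2 v_ge0.
apply: (@le_trans _ _ (\sum_x \sum_y walks j.-1 x2 z * (walks a x2 y * walks (j - a.+1) y z)
   / v x2 * ((conf x y)%:R * (S x2 x * v x)))).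
  apply: ler_sum => x _.
  apply: (@le_trans _ _ (S x x2 * (v x / v x2) * (walks j.-1 x2 z * G x x2 z))).
    rewrite /q ler_wpM2l ?mulr_ge0 ?invr_ge0//.
    by rewrite expr2 ler_wpM2r.
  rewrite /G mulr_sumr mulr_sumr; apply: ler_sum => y _.
  by rewrite le_eqVlt (S_sym x) -(rwP orP); left; apply/eqP; ring.
rewrite exchange_big /=.
apply: (@le_trans _ _ (\sum_y walks j.-1 x2 z * (walks a x2 y * walks (j - a.+1) y z) * delta)).
  apply: ler_sum => y _; rewrite -mulr_sumr -mulrA ler_wpM2l ?mulr_ge0 ?walks_ge0//.
  rewrite mulrC ler_pdivrMr//; apply: le_trans (S_v_conf x2 y).
  rewrite [X in _ <= X]big_mkcond; apply: ler_sum => x _.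
  by case: conf; rewrite ?mul1r ?mul0r.
rewrite -mulr_suml -mulr_sumr -walksD [X in _ <= X]mulrC.
by rewrite (_ : (a + (j - a.+1) = j.-1)%N); [rewrite expr2|lia].
Qed.

(** A union bound over pairs of positions: as [64 j^4] is the square of [8 j^2], each pair spoils at
    most a fraction [1 / (8 j^2)] of the closed walks. *)
Lemma exists_conf_free_closed_walk j : (0 < j)%N -> 0 < moment j ->
  (64 * j%:R ^+ 4) * (delta * moment j.-1) <= moment j ->
  exists x s, [/\ size s = (j + j)%N, path (fun y z => 0 < S y z) x s, last x s = x &
    forall i i', (i < i' < j + j)%N -> ~~ conf (nth x (x :: s) i) (nth x (x :: s) i')].
Proof.
move=> j0 mj small.
pose n := (j + j)%N.
pose P (p : 'I_n * 'I_n) := (p.1 < p.2)%N.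
(* Positive only if the walk is closed and free of conflicts, since each conflict of a closed walk
   subtracts [1]. *)
pose Psi x (s : seq U) : R :=
  (last x s == x)%:R - \sum_(p | P p) closed_conf p.1 p.2 x s.
have bound (p : 'I_n * 'I_n) : P p ->
    \sum_x walk_sum n x (closed_conf p.1 p.2 x) <= moment j / (8 * j%:R ^+ 2).
  case: p => i i'; rewrite /P /= => ii'; rewrite sum_closed_conf ?(ltnW ii') 1?ltnW//.
  have i'n := ltn_ord i'.
  (* The two arcs play symmetric roles, so the shorter one, of length at most [j], may be taken
     first. *)
  have [c [cj ->]] : exists c, (0 < c <= j)%N /\ conf_walks (i' - i) (n - (i' - i)) = conf_walks c (j + j - c).
    have [le|gt] := leqP (i' - i) j; first by exists (i' - i)%N; split=> //; lia.
    exists (n - (i' - i))%N; split; first by lia.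
    by rewrite conf_walksC -/n; congr conf_walks; lia.
  have J0 : 0 < 8 * j%:R ^+ 2 :> R by rewrite mulr_gt0// exprn_gt0// ltr0n.
  rewrite -ler_sqr ?nnegrE; last 2 first.
  - by do 2 apply: sumr_ge0 => ? _; rewrite !mulr_ge0 ?walks_ge0.
  - by rewrite divr_ge0// ltW.
  apply: le_trans (conf_walks_sqr_le cj) _.
  rewrite expr_div_n ler_pdivlMr ?exprn_gt0// [X in _ <= X]expr2.
  rewrite [X in X <= _](_ : _ = (64 * j%:R ^+ 4) * (delta * moment j.-1) * moment j); last by ring.
  by rewrite ler_pM2r.
have : 0 < \sum_x walk_sum n x (Psi x).
  under eq_bigr do rewrite /Psi walk_sumB.
  rewrite sumrB.
  have -> : \sum_x walk_sum n x (fun s => (last x s == x)%:R) = moment j.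
    rewrite moment_trace; apply: eq_bigr => x _.
    rewrite (walk_sum_last n x (fun y => (y == x)%:R)) -[RHS](sum_delta (walks n x)).
    by apply: eq_bigr => y _; rewrite mulrC eq_sym.
  under eq_bigr do rewrite walk_sum_sum.
  rewrite exchange_big /= subr_gt0.
  have J0 : 0 < j%:R :> R by rewrite ltr0n.
  (* There are at most [n^2 = 4 j^2] pairs, so the conflicts cost at most half of the moment. *)
  have -> : moment j = (n * n)%:R * (moment j / (8 * j%:R ^+ 2)) + moment j / 2.
    by rewrite natrM /n natrD; field; rewrite gt_eqF.
  rewrite ltr_pwDr ?divr_gt0//.
  rewrite -[in X in _ <= X](card_ord n) -card_prod mulr_natl -sumr_const.
  rewrite [X in X <= _]big_mkcond; apply: ler_sum => p _.
  case: ifP => [/bound//|_]; by rewrite divr_ge0 ?mulr_ge0 ?exprn_ge0 ?ltW.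
move=> pos.
have [x px] : exists x, 0 < walk_sum n x (Psi x).
  apply: contrapT => /forallNP N; move: pos; apply/negP; rewrite -leNgt.
  by apply: sumr_le0 => z _; rewrite leNgt; apply/negP/N.
have [s [ss ps]] := walk_sum_gt0 px.
rewrite /Psi; have [lx|nl] := eqVneq (last x s) x; last first.
  rewrite sub0r oppr_gt0 ltNge => /negP[].
  by apply: sumr_ge0 => p _; rewrite /closed_conf mulr_ge0.
rewrite subr_gt0 => lt1; exists x, s; split=> // i i' /andP[ii' i'n].
have i_n := ltn_trans ii' i'n.
apply/negP => c; move: lt1; apply/negP; rewrite -leNgt.
rewrite (bigD1 (Ordinal i_n, Ordinal i'n))//= /closed_conf lx eqxx mul1r c lerDl.
by apply: sumr_ge0 => p _; rewrite mulr_ge0.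
Qed.
End Walks.

(** * Cylinders from rings of triangles *)

(** The preimage of a closed set under [h] is the [phi]-image of a closed part of [K], hence
    compact, hence closed in the Hausdorff space [A]. *)
Lemma compact_lift_continuous (T A B : topologicalType) (K : set T)
    (phi : T -> A) (psi : T -> B) (h : A -> B) :
  compact K -> hausdorff_space A -> continuous phi -> continuous psi ->
  (forall a, K a -> h (phi a) = psi a) -> {within phi @` K, continuous h}.
Proof.
move=> cK hA cphi cpsi hE; apply/continuous_closedP => F clF.
apply/closed_subspaceP; exists (phi @` (K `&` psi @^-1` F)).
  apply: compact_closed => //; apply: continuous_compact.
    exact: continuous_subspaceT.
  by apply: compact_closedI => //; move/continuous_closedP: cpsi; exact.
apply/seteqP; split=> x /=.
  by move=> [[a [Ka Fa] <-] _]; split; [change (F (h (phi a))); rewrite hE|exists a].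
by move=> [Fx [a Ka ax]]; split; exists a => //; split=> //; change (F (psi a)); rewrite -hE// ax.
Qed.

(** Two Hausdorff quotients of one compact set by the same fibres are homeomorphic; continuity in
    each direction is the preceding lemma. *)
Lemma compact_quotient_homeomorphism (T A B : topologicalType)
    (a0 : T) (K : set T) (phi : T -> A) (psi : T -> B) :
  compact K -> hausdorff_space A -> hausdorff_space B ->
  continuous phi -> continuous psi ->
  (forall a b, K a -> K b -> phi a = phi b <-> psi a = psi b) ->
  exists2 h : A -> B, homeomorphism (phi @` K) (psi @` K) h &
    forall a, K a -> h (phi a) = psi a.
Proof.
move=> cK hA hB cphi cpsi E.
pose h x := psi (xget a0 [set a | K a /\ phi a = x]).
pose g y := phi (xget a0 [set a | K a /\ psi a = y]).
have hE a : K a -> h (phi a) = psi a.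
  move=> Ka; rewrite /h; case: xgetP => [b _ [Kb Eb]|/(_ a)[]//].
  exact/(E b a Kb Ka).
have gE a : K a -> g (psi a) = phi a.
  move=> Ka; rewrite /g; case: xgetP => [b _ [Kb Eb]|/(_ a)[]//].
  exact/(E b a Kb Ka).
exists h => //; split.
- split.
  + by move=> x [a Ka <-]; exists a => //; rewrite hE.
  + move=> x y /set_mem[a Ka <-] /set_mem[b Kb <-].
    by rewrite !hE// => /(E a b Ka Kb).
  + by move=> y [a Ka <-]; exists (phi a); [exists a|rewrite hE].
- exact: (compact_lift_continuous cK hA cphi cpsi).
- exists g; first exact: (compact_lift_continuous cK hB cpsi cphi).
  by move=> x /set_mem[a Ka <-]; rewrite hE// gE.
Qed.

Lemma circle_param (R : realType) (c d : R) : c ^+ 2 + d ^+ 2 = 1 ->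
  exists2 t, 0 <= t <= pi *+ 2 & c = cos t /\ d = sin t.
Proof.
move=> cd; have c1 : -1 <= c <= 1 by nra.
have := acos_ge0 c1; have := acos_lepi c1.
have cE : cos (acos c) = c by rewrite acosK// in_itv.
have sE := sin_acos c1.
have {}sE : sin (acos c) = `|d| by rewrite sE -sqrtr_sqr; congr Num.sqrt; lra.
move=> h1 h2; have pi0 := @pi_gt0 R.
have [d0|d0] := lerP 0 d.
  exists (acos c); first by rewrite mulr2n; lra.
  by rewrite cE sE ger0_norm.
exists (pi *+ 2 - acos c); first by rewrite mulr2n; lra.
by rewrite cosB sinB cos2pi sin2pi cE sE ltr0_norm//; split; ring.
Qed.

(** The cosine of the difference is [1], so the sine of the half difference vanishes; that half lies
    in [[0, pi]], where only the ends are possible. *)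
Lemma circle_param_inj (R : realType) (t u : R) :
  0 <= t <= pi *+ 2 -> 0 <= u <= pi *+ 2 -> cos t = cos u -> sin t = sin u ->
  [\/ t = u, t = 0 /\ u = pi *+ 2 | t = pi *+ 2 /\ u = 0].
Proof.
wlog tu : t u / t <= u => [wl ht hu ct st|].
  have [/wl|/ltW/wl] := leP t u; first exact.
  by move=> /(_ hu ht (esym ct) (esym st))[->|[-> ->]|[-> ->]];
    [apply: Or31|apply: Or33|apply: Or32].
move=> ht hu ct st.
have : cos (u - t) = 1 by rewrite cosB ct st -!expr2 cos2Dsin2.
have -> : u - t = ((u - t) / 2) *+ 2 by rewrite mulr2n; field.
rewrite cos_mulr2n cos2sin2 => h.
have s0 : sin ((u - t) / 2) = 0.
  apply/eqP; rewrite -sqrf_eq0; apply/eqP; move: h; rewrite mulr2n; lra.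
rewrite mulr2n in ht hu *.
case: (ltgtP t u) tu => // [tu _|->]; last by move=> _; apply: Or31.
have [lt|ge] := ltP ((u - t) / 2) pi; last by apply: Or32; split; lra.
have := @sin_gt0_pi R ((u - t) / 2).
by rewrite s0 ltxx lt andbT divr_gt0 ?subr_gt0// => /(_ isT).
Qed.

Lemma ptws_continuous (T U : topologicalType) (I : eqType) (f : T -> {ptws I -> U}) :
  (forall i, continuous (fun x => f x i)) -> continuous f.
Proof.
move=> cf x; apply/cvg_sup => i.
move=> W [?/= [[C oC <-]]] /= Cfx /filterS; apply; apply: (cf i x).
exact: open_nbhs_nbhs.
Qed.

Lemma ptws_hausdorff (U : topologicalType) (I : eqType) :
  hausdorff_space U -> hausdorff_space {ptws I -> U}.
Proof. by move=> hU; apply: (@hausdorff_product I (fun=> U)) => _. Qed.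

(** * The ring of triangles as a quotient of a rectangle *)

Section Ring.
Variables (R : realType) (V : finType) (N : nat) (a b : nat -> V).
Implicit Types (p : R * R) (t u s : R).

(** Tent functions: on [[0, N]] they form a partition of unity in which only the two columns around
    [t] carry mass. *)
Definition hat t k : R := Num.max 0 (1 - `|t - k%:R|).

Definition side (k : nat) s : R := if odd k then 1 - s else s.

Lemma side_itv i s : 0 <= s <= 1 -> 0 <= side i s <= 1.
Proof. by move=> s01; rewrite /side; case: odd; lra. Qed.

(* Column [k] of the ring consists of the vertices [a k] and [b k]; at the point with
   coordinates [(t, s)] it has mass [hat t k], of which [b k] takes as much as the height
   allows. The triangles use the diagonals [b k], [b k.+1], so [b] is alternately at the
   top and at the bottom, which is what [side] records. Column [N] is column [0]. *)
Definition ring_point p : {ptws V -> R} := fun w =>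
  \sum_(k < N.+1) ((w == b k)%:R * Num.min (side k p.2) (hat p.1 k) +
                   (w == a k)%:R * Num.max 0 (hat p.1 k - side k p.2)).

Lemma ring_point_continuous : continuous ring_point.
Proof.
apply: ptws_continuous => w p; rewrite /ring_point.
have cmin (f g : R * R -> R) : f @ p --> f p -> g @ p --> g p ->
    (fun q => Num.min (f q) (g q)) @ p --> Num.min (f p) (g p).
  by move=> cf cg; exact: (@continuous_min R _ f g p).
have cmax (f g : R * R -> R) : f @ p --> f p -> g @ p --> g p ->
    (fun q => Num.max (f q) (g q)) @ p --> Num.max (f p) (g p).
  by move=> cf cg; exact: (@continuous_max R _ f g p).
have chat k : (fun q : R * R => hat q.1 k) @ p --> hat p.1 k.
  apply: (cmax (fun=> 0) (fun q => 1 - `|q.1 - k%:R|)); first exact: cvg_cst.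
  apply: cvgB; first exact: cvg_cst.
  apply: cvg_norm; apply: cvgB; [exact: cvg_fst|exact: cvg_cst].
have cside k : (fun q : R * R => side k q.2) @ p --> side k p.2.
  rewrite /side; case: odd; last exact: cvg_snd.
  by apply: cvgB; [exact: cvg_cst|exact: cvg_snd].
apply: cvg_big; first exact: add_continuous.
move=> k _; apply: cvgD; apply: cvgM; try exact: cvg_cst.
- exact: (cmin (fun q => side k q.2) (fun q => hat q.1 k)).
- apply: (cmax (fun=> 0) (fun q => hat q.1 k - side k q.2)); first exact: cvg_cst.
  exact: cvgB.
Qed.

Lemma hat0 t k : 1 <= `|t - k%:R| -> hat t k = 0.
Proof. by move=> h; rewrite /hat; apply/max_idPl; lra. Qed.

Lemma hat_quad i u : 0 <= u <= 1 -> hat (i%:R + u) i = 1 - u.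
Proof.
move=> u01; rewrite /hat (_ : i%:R + u - i%:R = u); last by ring.
by rewrite ger0_norm; [apply/max_idPr|]; lra.
Qed.

Lemma hat_quadS i u : 0 <= u <= 1 -> hat (i%:R + u) i.+1 = u.
Proof.
move=> u01; rewrite /hat -natr1 (_ : i%:R + u - (i%:R + 1) = - (1 - u)); last by ring.
by rewrite normrN ger0_norm; [rewrite (_ : 1 - _ = u); [apply/max_idPr|ring]|]; lra.
Qed.

Lemma ring_pointE i u s w : (i < N)%N -> 0 <= u <= 1 -> 0 <= s <= 1 ->
  ring_point (i%:R + u, s) w =
    (w == b i)%:R * Num.min (side i s) (1 - u) +
    (w == a i)%:R * Num.max 0 (1 - u - side i s) +
    ((w == b i.+1)%:R * Num.min (1 - side i s) u +
     (w == a i.+1)%:R * Num.max 0 (u - (1 - side i s))).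
Proof.
move=> iN u01 s01.
have i1 : (i < N.+1)%N by lia.
have i2 : (i.+1 < N.+1)%N by lia.
rewrite /ring_point /= (bigD1 (Ordinal i1))//= (bigD1 (Ordinal i2))/=; last first.
  by apply/eqP => /(congr1 val)/=; lia.
rewrite big1 ?addr0 => [|k /andP[ki ki1]].
  rewrite hat_quad// hat_quadS//.
  have -> : side i.+1 s = 1 - side i s by rewrite /side /=; case: odd => /=; ring.
  by [].
have -> : hat (i%:R + u) k = 0.
  have {}ki : (k != i :> nat) by [].
  have {}ki1 : (k != i.+1 :> nat) by [].
  have [lt|ge] := ltnP k i.
    have : (k.+1%:R <= i%:R :> R) by rewrite ler_nat.
    by rewrite -natr1 => h; apply: hat0; rewrite ger0_norm; lra.
  have : (i.+2%:R <= k%:R :> R) by rewrite ler_nat; lia.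
  by rewrite -natr1 -natr1 => h; apply: hat0; rewrite ler0_norm; lra.
have s0 := side_itv k s01.
rewrite (min_idPr _); last by lra.
by rewrite (max_idPl _) ?mulr0 ?addr0//; lra.
Qed.

Definition ring_circle p : (R * R) * R :=
  ((cos (pi *+ 2 * (p.1 / N%:R)), sin (pi *+ 2 * (p.1 / N%:R))), p.2).

Lemma ring_circle_continuous : continuous ring_circle.
Proof.
move=> p; rewrite /ring_circle.
have c : (fun q : R * R => pi *+ 2 * (q.1 / N%:R)) @ p --> pi *+ 2 * (p.1 / N%:R).
  by apply: cvgM; [exact: cvg_cst|apply: cvgM; [exact: cvg_fst|exact: cvg_cst]].
have cc := cvg_comp _ _ c (@continuous_cos R _).
have cs := cvg_comp _ _ c (@continuous_sin R _).
exact: (cvg_pair (cvg_pair cc cs) (@cvg_snd _ _ _ _ _)).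
Qed.

Definition ring_domain : set (R * R) := `[0, N%:R] `*` `[0, 1].

Hypothesis N_gt2 : (2 < N)%N.
Hypothesis N_even : ~~ odd N.
Hypothesis aN : a N = a 0.
Hypothesis bN : b N = b 0.
Hypothesis ab_neq : forall i j, (i < N)%N -> (j < N)%N -> a i != b j.
Hypothesis a_inj : forall i j, (i < N)%N -> (j < N)%N -> a i = a j -> i = j.
Hypothesis b_inj : forall i j, (i < N)%N -> (j < N)%N -> b i = b j -> i = j.

Lemma ring_circle_image : ring_circle @` ring_domain = @cylinder R.
Proof.
have N0 : 0 < N%:R :> R by rewrite ltr0n; lia.
apply/seteqP; split => [_ [[t s] [/= t0 s0] <-]|[[c d] s] [/= cd s0]].
  by split => //=; rewrite /circle /= cos2Dsin2.
have [t /andP[t0 t2] [cE dE]] := circle_param cd.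
have pi0 := @pi_gt0 R.
have p0 : 0 < pi *+ 2 :> R by rewrite mulr2n; lra.
exists (t / (pi *+ 2) * N%:R, s).
  split=> //=; rewrite in_itv /= mulr_ge0 ?divr_ge0 ?(ltW p0) ?(ltW N0)//=.
  by rewrite ler_piMl ?(ltW N0)// ler_pdivrMr// mul1r.
rewrite /ring_circle /= mulfK ?gt_eqF// mulrC divfK ?gt_eqF//.
by rewrite -cE -dE.
Qed.

Lemma ring_domainP p : ring_domain p ->
  exists i u, [/\ (i < N)%N, 0 <= u <= 1, p.1 = i%:R + u & 0 <= p.2 <= 1].
Proof.
case: p => t s [/=]; rewrite !in_itv /= => /andP[t0 tN] s01.
have [->|tn] := eqVneq t N%:R.
  exists N.-1, 1; split=> //; [by lia|lra|].
  by rewrite natr1; congr (_%:R); lia.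
have /andP[h1 h2] := truncn_itv t0.
exists (Num.truncn t), (t - (Num.truncn t)%:R); split=> //.
- by rewrite -(ltr_nat R); apply: le_lt_trans h1 _; rewrite lt_neqAle tn.
- by move: h2; rewrite -natr1; lra.
- by ring.
Qed.

(** Evenness of [N] enters here: column [N] has the orientation of column [0], so the ends of the
    rectangle are glued without a flip. *)
Lemma ring_point_wrap s : 0 <= s <= 1 -> ring_point (0, s) = ring_point (N%:R, s).
Proof.
move=> s01; apply: funext => w.
have -> : N%:R = N.-1%:R + 1 :> R by rewrite natr1; congr (_%:R); lia.
rewrite -[X in ring_point (X, _)](addr0 (0%:R)) !ring_pointE//; try lra; try lia.
rewrite (_ : N.-1.+1 = N); last by lia.
rewrite aN bN.
have -> : side N.-1 s = 1 - s.
  by rewrite /side (_ : odd N.-1)//; case: (N) N_gt2 N_even => //= n _; rewrite negbK.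
rewrite /side /=.
rewrite (_ : Num.min s (1 - 0) = s); last by case: leP; lra.
rewrite (_ : Num.max 0 (1 - 0 - s) = 1 - s); last by case: leP; lra.
rewrite (_ : Num.min (1 - s) 0 = 0); last by case: leP; lra.
rewrite (_ : Num.max 0 (0 - (1 - s)) = 0); last by case: leP; lra.
rewrite (_ : Num.min (1 - s) (1 - 1) = 0); last by case: leP; lra.
rewrite (_ : Num.max 0 (1 - 1 - (1 - s)) = 0); last by case: leP; lra.
rewrite (_ : Num.min (1 - (1 - s)) 1 = s); last by case: leP; lra.
rewrite (_ : Num.max 0 (1 - (1 - (1 - s))) = 1 - s); last by case: leP; lra.
by rewrite !mulr0 !addr0 !add0r.
Qed.

Lemma quad_uniq i : (i < N)%N -> uniq [:: b i; a i; b i.+1; a i.+1].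
Proof.
move=> iN.
(* Column [N] is column [0], so [i.+1] is brought below [N], where injectivity applies. *)
have [j [jN ij aj bj]] : exists j, [/\ (j < N)%N, i != j, a i.+1 = a j & b i.+1 = b j].
  have [E|ne] := eqVneq i.+1 N; first by exists 0%N; rewrite E; split=> //; lia.
  by exists i.+1; split=> //; lia.
have ha : a i != a j by apply: contraNneq ij => /a_inj ->.
have hb : b i != b j by apply: contraNneq ij => /b_inj ->.
have ba k l : (k < N)%N -> (l < N)%N -> b k != a l by move=> kN lN; rewrite eq_sym ab_neq.
by rewrite aj bj /= !inE !negb_or ha hb !ba// ab_neq.
Qed.

Section QuadValues.
Variables (i : nat) (u s : R).
Hypotheses (iN : (i < N)%N) (u01 : 0 <= u <= 1) (s01 : 0 <= s <= 1).
Let x := ring_point (i%:R + u, s).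
Let sg := side i s.

Lemma ring_point_quad :
  [/\ x (b i) = Num.min sg (1 - u), x (a i) = Num.max 0 (1 - u - sg),
      x (b i.+1) = Num.min (1 - sg) u & x (a i.+1) = Num.max 0 (u - (1 - sg))].
Proof.
have := quad_uniq iN; rewrite /= !inE !negb_or !andbT => /and3P[/and3P[n1 n2 n3] /andP[n4 n5] n6].
by split; rewrite /x ring_pointE// ?eqxx
  1?[a i == b i]eq_sym 1?[b i.+1 == b i]eq_sym 1?[b i.+1 == a i]eq_sym
  1?[a i.+1 == b i]eq_sym 1?[a i.+1 == a i]eq_sym 1?[a i.+1 == b i.+1]eq_sym
  ?(negbTE n1) ?(negbTE n2) ?(negbTE n3) ?(negbTE n4) ?(negbTE n5) ?(negbTE n6)
  ?mul0r ?mul1r ?add0r ?addr0.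
Qed.

Lemma ring_point_out w : w \notin [:: b i; a i; b i.+1; a i.+1] -> x w = 0.
Proof.
rewrite !inE !negb_or => /and4P[n1 n2 n3 n4].
rewrite /x ring_pointE//.
by rewrite (negbTE n1) (negbTE n2) (negbTE n3) (negbTE n4) !mul0r !addr0.
Qed.
End QuadValues.

(** The total mass of an interior column does not depend on the height, so the horizontal coordinate
    can be recovered from it. *)
Lemma ring_point_mass k p : (0 < k < N)%N ->
  ring_point p (b k) + ring_point p (a k) = hat p.1 k.
Proof.
move=> /andP[k0 kN].
have kN1 : (k < N.+1)%N by lia.
have red (c : nat -> V) (j : nat) : c N = c 0 ->
    (forall i j, (i < N)%N -> (j < N)%N -> c i = c j -> i = j) ->
    (j < N.+1)%N -> j != k -> c k == c j = false.
  move=> cN cinj jN jk; apply/eqP => E.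
  have [jE|jE] := eqVneq j N.
    by move: E; rewrite jE cN => /cinj; lia.
  by move/cinj: E; lia.
have red2 (j : nat) : (j < N.+1)%N -> (a k == b j = false) * (b k == a j = false).
  move=> jN; have [jE|jE] := eqVneq j N.
    rewrite jE aN bN; split; first by apply/negbTE/ab_neq; lia.
    by rewrite eq_sym; apply/negbTE/ab_neq; lia.
  split; first by apply/negbTE/ab_neq; lia.
  by rewrite eq_sym; apply/negbTE/ab_neq; lia.
have -> : ring_point p (b k) = Num.min (side k p.2) (hat p.1 k).
  rewrite /ring_point (bigD1 (Ordinal kN1))//= big1 => [|j jk].
    by rewrite (red2 k kN1) eqxx mul0r mul1r !addr0.
  by rewrite (red2 j (ltn_ord j)) (red b j)// ?mul0r ?addr0.
have -> : ring_point p (a k) = Num.max 0 (hat p.1 k - side k p.2).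
  rewrite /ring_point (bigD1 (Ordinal kN1))//= big1 => [|j jk].
    by rewrite (red2 k kN1) eqxx mul0r mul1r addr0 add0r.
  by rewrite (red2 j (ltn_ord j)) (red a j)// ?mul0r ?addr0.
have [h|h] := leP (side k p.2) (hat p.1 k).
  by rewrite (max_idPr _) ?subr_ge0//; ring.
by rewrite (max_idPl _) ?addr0// subr_le0 ltW.
Qed.

Lemma hat_eq1 t k : hat t k = 1 -> t = k%:R.
Proof.
rewrite /hat; case: leP => [_ h|_ h]; last by lra.
by apply/eqP; rewrite -subr_eq0 -normr_eq0; apply/eqP; lra.
Qed.

Lemma hat_le0 t k : t <= k%:R -> t + 1 <= k%:R -> hat t k = 0.
Proof. by move=> h1 h2; apply: hat0; rewrite ler0_norm; lra. Qed.

Lemma hat_ge0 t k : k%:R + 1 <= t -> hat t k = 0.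
Proof. by move=> h; apply: hat0; rewrite ger0_norm; lra. Qed.

(** Compare cells [i <= i']: an interior column next to one point but far from the other has mass
    zero, which pushes the first point to the end of its cell. [N > 2] matters: for [N = 2] the
    points [t] and [2 - t] would agree. *)
Lemma hat_inj t t' : 0 <= t <= N%:R -> 0 <= t' <= N%:R ->
  (forall k, (0 < k < N)%N -> hat t k = hat t' k) ->
  [\/ t = t', t = 0 /\ t' = N%:R | t = N%:R /\ t' = 0].
Proof.
have dom (r : R) : 0 <= r <= N%:R -> ring_domain (r, 0).
  by move=> h; split; rewrite /= in_itv/=; lra.
move=> /dom/ring_domainP[i [u [iN u01 /= tE _]]] /dom/ring_domainP[i' [u' [i'N u'01 /= tE' _]]].
wlog ii' : i i' u u' t t' iN i'N u01 u'01 tE tE' / (i <= i')%N => [wl|] hh.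
  have [le|/ltnW le] := leqP i i'; first exact: (wl i i' u u').
  have /(_ _)[k kN||[]|[]] := wl i' i u' u t' t i'N iN u'01 u01 tE' tE le.
  - by rewrite hh.
  - by move=> ->; apply: Or31.
  - by move=> -> ->; apply: Or33.
  - by move=> -> ->; apply: Or32.
rewrite {}tE {}tE' in hh *.
have [E|ne] := eqVneq i i'.
  rewrite -E in hh *; apply: Or31; congr (_ + _).
  have [k1|k1] := ltnP i.+1 N; first by have := hh i.+1; rewrite !hat_quadS//; apply; lia.
  by have := hh i ltac:(lia); rewrite !hat_quad//; lra.
have lt : (i.+1 <= i')%N by lia.
have ltR : i%:R + 1 <= i'%:R :> R by rewrite natr1 ler_nat.
have [k1|k1] := ltnP i'.+1 N.
  have := hh i'.+1 ltac:(lia); rewrite hat_quadS// hat_le0; try (rewrite -natr1; lra).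
  move=> u'0; have := hh i' ltac:(lia); rewrite -u'0 hat_quad; last by lra.
  rewrite subr0 => /hat_eq1 ->; apply: Or31; by rewrite addr0.
have [i0|i0] := posnP i.
  have i'E : i' = N.-1 by lia.
  have i'2 : 2 <= i'%:R :> R by rewrite ler_nat; lia.
  have := hh 1%N ltac:(lia); have := hh i' ltac:(lia).
  rewrite i0 hat_quadS// hat_quad// hat_le0; try lra.
  rewrite hat_ge0; last by lra.
  move=> e1 e2; apply: Or32; split; first by lra.
  by rewrite (_ : N = i'.+1) -?natr1; [lra|lia].
have := hh i ltac:(lia); rewrite hat_quad// hat_ge0; last by lra.
move=> h1; have := hh i.+1 ltac:(lia); rewrite hat_quadS//.
have -> : u = 1 by lra.
move=> /esym/hat_eq1 ->; apply: Or31; by rewrite natr1.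
Qed.

(** Both maps identify exactly [(0, s)] with [(N, s)]. For [ring_point], column masses determine [t]
    up to the ends, and the masses within a cell then determine [s]. *)
Lemma ring_point_circle p q : ring_domain p -> ring_domain q ->
  ring_point p = ring_point q <-> ring_circle p = ring_circle q.
Proof.
case: p q => [t s] [t' s'] Dp Dq.
have [/= t0N s01] := Dp; have [/= t'0N s'01] := Dq.
rewrite !in_itv /= in t0N t'0N s01 s'01.
have N0 : 0 < N%:R :> R by rewrite ltr0n; lia.
have p0 : 0 < pi *+ 2 :> R by rewrite mulr2n addr_gt0 ?pi_gt0.
have sideN : side N.-1 s' = 1 - s' /\ side N.-1 s = 1 - s.
  by rewrite /side (_ : odd N.-1)//; case: (N) N_gt2 N_even => //= n _; rewrite negbK.
have wrap (r r' : R) : 0 <= r <= 1 -> 0 <= r' <= 1 ->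
    ring_point (0, r) = ring_point (N%:R, r') -> r = r'.
  move=> r01 r'01; rewrite -ring_point_wrap// => E.
  have iN : (0 < N)%N by exact: ltn_trans N_gt2.
  have u0 : 0 <= (0 : R) <= 1 by lra.
  have [+ _ _ _] := @ring_point_quad 0 0 r iN u0 r01.
  have [+ _ _ _] := @ring_point_quad 0 0 r' iN u0 r'01.
  rewrite /side /= addr0 E subr0 => ->.
  by rewrite !(min_idPl _); lra.
split=> [E|[]].
  have : [\/ t = t', t = 0 /\ t' = N%:R | t = N%:R /\ t' = 0].
    apply: hat_inj => // k kN.
    by rewrite -[LHS](ring_point_mass (t, s))// -[RHS](ring_point_mass (t', s'))// E.
  case=> [tE|[tE tE']|[tE tE']].
  - rewrite /ring_circle /= tE; congr (_, _).
    have [i [u [iN u01 /= iu _]]] := ring_domainP Dp.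
    move: E; rewrite -tE iu => E.
    (* The height is the sum of the coordinates of [b i] and [a i.+1]. *)
    have minmax (x : R) : Num.min x (1 - u) + Num.max 0 (u - (1 - x)) = x.
      by case: leP => ?; case: leP => ?; lra.
    have [h1 _ _ h2] := @ring_point_quad i u s iN u01 s01.
    have [h1' _ _ h2'] := @ring_point_quad i u s' iN u01 s'01.
    have {h1 h1'} := etrans (esym h1) (etrans (congr1 (fun f : {ptws V -> R} => f (b i)) E) h1').
    have {h2 h2'} := etrans (esym h2) (etrans (congr1 (fun f : {ptws V -> R} => f (a i.+1)) E) h2').
    move=> h1 h2; have : side i s = side i s' by rewrite -[LHS]minmax -[RHS]minmax h1 h2.
    by rewrite /side; case: odd; lra.
  - move: E; rewrite tE tE' => /wrap-> //.
    by rewrite /ring_circle /= mul0r mulr0 divff ?gt_eqF// mulr1 cos0 sin0 cos2pi sin2pi.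
  - move: E; rewrite tE tE' => /esym/wrap-> //.
    by rewrite /ring_circle /= mul0r mulr0 divff ?gt_eqF// mulr1 cos0 sin0 cos2pi sin2pi.
rewrite /= => ct st ->.
have itv (r : R) : 0 <= r <= N%:R -> 0 <= pi *+ 2 * (r / N%:R) <= pi *+ 2.
  move=> /andP[r0 rN]; rewrite mulr_ge0 ?divr_ge0 ?(ltW p0) ?(ltW N0)//=.
  by rewrite ler_piMr ?(ltW p0)// ler_pdivrMr// mul1r.
have eq0 (r : R) : pi *+ 2 * (r / N%:R) = 0 -> r = 0.
  by move=> /eqP; rewrite !mulf_eq0 invr_eq0 (gt_eqF p0) (gt_eqF N0) orbF /= => /eqP.
have eqN (r : R) : pi *+ 2 * (r / N%:R) = pi *+ 2 -> r = N%:R.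
  rewrite -[X in _ = X]mulr1 => /(mulfI _) h.
  by have /divr1_eq := h ltac:(by rewrite gt_eqF).
have := circle_param_inj (itv t t0N) (itv t' t'0N) ct st.
case=> [E|[/eq0-> /eqN->]|[/eqN-> /eq0->]].
- congr (ring_point (_, _)).
  by move/(mulfI (lt0r_neq0 p0)): E => /(mulIf (invr_neq0 (lt0r_neq0 N0))).
- exact: ring_point_wrap.
- by rewrite ring_point_wrap.
Qed.

Definition ring_hypergraph : {set {set V}} :=
  ([set [set a k; b k; b k.+1] | k : 'I_N] :|:
   [set [set b k; b k.+1; a k.+1] | k : 'I_N])%SET.

Lemma ring_hypergraphP e : reflect
  (exists2 k, (k < N)%N & e = [set a k; b k; b k.+1]%SET \/ e = [set b k; b k.+1; a k.+1]%SET)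
  (e \in ring_hypergraph).
Proof.
apply: (iffP idP) => [|[k kN [->|->]]].
- rewrite inE => /orP[] /imsetP[k _ ->]; exists (val k); rewrite ?ltn_ord//.
  + by left.
  + by right.
- by rewrite inE; apply/orP; left; apply/imsetP; exists (Ordinal kN).
- by rewrite inE; apply/orP; right; apply/imsetP; exists (Ordinal kN).
Qed.

Lemma ring_hypergraph_uniform : uniform3 ring_hypergraph.
Proof.
move=> e /ring_hypergraphP[k kN E].
have := quad_uniq kN; rewrite /= !inE !negb_or !andbT => /and3P[/and3P[n1 n2 n3] /andP[n4 n5] n6].
case: E => ->.
- by rewrite -finset.setUA cardsU1 !inE negb_or [a k == b k]eq_sym n1 n4 cards2 n2.
- by rewrite -finset.setUA cardsU1 !inE negb_or n2 n3 cards2 n6.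
Qed.

(** The unique [a]-vertex of a triangle fixes its index within each kind. A triangle of both kinds
    would make [b k.+1] and the cyclic predecessor of [b k] coincide, which [N > 2] excludes. *)
Lemma card_ring_hypergraph : #|ring_hypergraph| = (N + N)%N.
Proof.
pose nx l := if l.+1 == N then 0%N else l.+1.
have nxN l : (l < N)%N -> (nx l < N)%N by rewrite /nx; case: eqP; lia.
have anx l : a l.+1 = a (nx l) by rewrite /nx; case: eqP => [->|].
have bnx l : b l.+1 = b (nx l) by rewrite /nx; case: eqP => [->|].
have aE l m : (l < N)%N -> (m < N)%N -> (a l == a m) = (l == m).
  by move=> lN mN; apply/eqP/eqP => [/a_inj->//|->].
have bE l m : (l < N)%N -> (m < N)%N -> (b l == b m) = (l == m).
  by move=> lN mN; apply/eqP/eqP => [/b_inj->//|->].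
have abE l m : (l < N)%N -> (m < N)%N -> (a l == b m) = false.
  by move=> lN mN; apply/negbTE/ab_neq.
have baE l m : (l < N)%N -> (m < N)%N -> (b l == a m) = false.
  by move=> lN mN; rewrite eq_sym; exact: abE.
rewrite /ring_hypergraph cardsU.
rewrite (_ : (_ :&: _)%SET = finset.set0) ?cards0 ?subn0; last first.
  apply/finset.setP => e; rewrite !inE; apply/negP => /andP[/imsetP[k _ ->] /imsetP[l _]].
  move=> /finset.setP E; have kN := ltn_ord k; have lN := ltn_ord l.
  have := E (a k); have := E (b k.+1); have := E (b k).
  rewrite !inE !anx !bnx !eqxx !(aE, bE, abE, baE) ?nxN// !orbT !orbF /=.
  move=> /esym h1 /esym h2 /esym h3.
  by move: h1 h2 h3; rewrite /nx; do 2 case: ifP; lia.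
rewrite !card_imset ?card_ord// => k l /finset.setP E; apply/val_inj => /=;
  have kN := ltn_ord k; have lN := ltn_ord l.
- have := E (a k.+1); rewrite !inE !anx !bnx !eqxx !(aE, bE, abE, baE) ?nxN// !orbT /=.
  by move=> /esym; rewrite /nx; do 2 case: ifP; lia.
- have := E (a k); rewrite !inE !bnx !eqxx !(aE, bE, abE, baE) ?nxN// !orbF.
  by move=> /esym/eqP.
Qed.

Lemma sum_uniq_support (x : {ptws V -> R}) (r : seq V) : uniq r ->
  (forall w, w \notin r -> x w = 0) -> \sum_w x w = \sum_(w <- r) x w.
Proof.
move=> ur x0; rewrite (big_uniq _ ur) /= [RHS]big_mkcond; apply: eq_bigr => w _.
by case: ifPn => // /x0.
Qed.

Lemma ring_point_image : ring_point @` ring_domain = @realization R V ring_hypergraph.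
Proof.
apply/seteqP; split=> [_ [[t s] Dp <-]|x [x0 x1 [e /ring_hypergraphP[i iN eE] xe]]].
  have [i [u [iN u01 /= -> s01]]] := ring_domainP Dp.
  have [h1 h2 h3 h4] := @ring_point_quad i u s iN u01 s01.
  have h5 := @ring_point_out i u s iN u01 s01.
  set x := ring_point _ in h1 h2 h3 h4 h5 *.
  have sg := side_itv i s01.
  have := quad_uniq iN; rewrite /= !inE !negb_or !andbT => /and3P[/and3P[n1 n2 n3] /andP[n4 n5] n6].
  split.
  - move=> w; have [|/h5->//] := boolP (w \in [:: b i; a i; b i.+1; a i.+1]).
    rewrite !inE => /or4P[] /eqP->; rewrite ?h1 ?h2 ?h3 ?h4 ?le_max ?lexx//.
    + by rewrite le_min; lra.
    + by rewrite le_min; lra.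
  - rewrite (sum_uniq_support (quad_uniq iN) h5) !big_cons big_nil h1 h2 h3 h4.
    by case: leP => ?; case: leP => ?; case: leP => ?; case: leP => ?; lra.
  (* The line [side i s = 1 - u] is the diagonal of the cell; its two sides are the two
     triangles. *)
  have [h|h] := leP (side i s) (1 - u).
    exists [set a i; b i; b i.+1]%SET; first by apply/ring_hypergraphP; exists i => //; left.
    move=> w; rewrite !inE !negb_or => /andP[/andP[m1 m2] m3].
    have [->|m4] := eqVneq w (a i.+1); last by apply: h5; rewrite !inE !negb_or m1 m2 m3.
    by rewrite h4; apply/max_idPl; lra.
  exists [set b i; b i.+1; a i.+1]%SET; first by apply/ring_hypergraphP; exists i => //; right.
  move=> w; rewrite !inE !negb_or => /andP[/andP[m1 m2] m3].
  have [->|m4] := eqVneq w (a i); last by apply: h5; rewrite !inE !negb_or m1 m2 m3 m4.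
  by rewrite h2; apply/max_idPl; lra.
have ui := quad_uniq iN.
have xout w : w \notin [:: b i; a i; b i.+1; a i.+1] -> x w = 0.
  rewrite !inE !negb_or => /and4P[m1 m2 m3 m4]; apply: xe.
  by case: eE => ->; rewrite !inE !negb_or ?m1 ?m2 ?m3 ?m4.
move: x1; rewrite (sum_uniq_support ui xout) !big_cons big_nil.
have := quad_uniq iN; rewrite /= !inE !negb_or !andbT => /and3P[/and3P[n1 n2 n3] /andP[n4 n5] n6].
have zero : x (a i.+1) = 0 \/ x (a i) = 0.
  case: eE => eE; [left|right]; apply: xe; rewrite eE !inE !negb_or.
    by rewrite ![a i.+1 == _]eq_sym n3 n5 n6.
  by rewrite [a i == b i]eq_sym n1 n4 n5.
have := x0 (b i); have := x0 (a i); have := x0 (b i.+1); have := x0 (a i.+1).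
move=> p4 p3 p2 p1 sum1.
(* The inverse coordinates: [u] is the mass of column [i.+1] and [sg] the height. They invert the
   formulas because one of the two [a]-coordinates is zero. *)
pose u := x (b i.+1) + x (a i.+1); pose sg := x (b i) + x (a i.+1).
pose s := side i sg.
have u01 : 0 <= u <= 1 by rewrite /u; lra.
have sg01 : 0 <= sg <= 1 by rewrite /sg; lra.
have s01 : 0 <= s <= 1 by rewrite /s /side; case: odd; lra.
have sE : side i s = sg by rewrite /s /side; case: odd; lra.
exists (i%:R + u, s).
  split; rewrite /= in_itv /= ?s01//.
  have : i%:R + 1 <= N%:R :> R by rewrite natr1 ler_nat.
  have : 0 <= i%:R :> R by [].
  by lra.
apply: funext => w.
have [h1 h2 h3 h4] := @ring_point_quad i u s iN u01 s01.
have h5 := @ring_point_out i u s iN u01 s01.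
have [|wn] := boolP (w \in [:: b i; a i; b i.+1; a i.+1]); last by rewrite h5// xout.
by rewrite !inE => /or4P[] /eqP->; rewrite ?h1 ?h2 ?h3 ?h4 sE;
  case: leP; rewrite /u /sg; case: zero; lra.
Qed.

Lemma ring_cylinder_cycle : cylinder_cycle R ring_hypergraph.
Proof.
split; first exact: ring_hypergraph_uniform.
have [||||||h hh hE] := @compact_quotient_homeomorphism _ _ _ (0, 0) ring_domain
  ring_point (ring_circle).
- by apply: compact_setX; exact: segment_compact.
- by apply: ptws_hausdorff; exact: Rhausdorff.
- exact: norm_hausdorff.
- exact: ring_point_continuous.
- exact: ring_circle_continuous.
- exact: ring_point_circle.
exists h; first by rewrite -ring_point_image -ring_circle_image.
(* Column ends go to the boundary circles; below, every vertex is identified with such an end. *)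
have corner k (r : R) : (k < N)%N -> r = 0 \/ r = 1 ->
    h (ring_point (k%:R + 0, r)) \in @cylinder_boundary R.
  move=> kN r01; rewrite hE.
    by apply/mem_set; split=> /=; [rewrite /circle /= cos2Dsin2|case: r01; [left|right]].
  split; rewrite /= in_itv /= ?addr0 ?ler0n ?ler_nat ?(ltnW kN)//.
  by case: r01 => ->; rewrite lexx ler01.
have sideK k (r : R) : side k (side k r) = r by rewrite /side; case: odd; ring.
have vb k : (k < N)%N -> @vertex_point R V (b k) = ring_point (k%:R + 0, side k 1).
  move=> kN; apply: funext => w; rewrite ring_pointE//; first last.
  - by rewrite /side; case: odd; lra.
  - by lra.
  rewrite sideK !subr0 subrr maxxx minxx (min_idPl _) ?ler01// sub0r oppr0 maxxx.
  by rewrite mulr1 !mulr0 !addr0.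
have va k : (k < N)%N -> @vertex_point R V (a k) = ring_point (k%:R + 0, side k 0).
  move=> kN; apply: funext => w; rewrite ring_pointE//; first last.
  - by rewrite /side; case: odd; lra.
  - by lra.
  rewrite sideK !subr0 (min_idPl _) ?ler01// (max_idPr _) ?ler01// (min_idPr _) ?ler01//.
  rewrite (max_idPl _) ?sub0r ?oppr_le0 ?ler01//.
  by rewrite mulr1 !mulr0 !addr0 add0r.
have side01 k : (side k 1 = 0 \/ side k 1 = 1) /\ (side k 0 = 0 \/ side k 0 = 1).
  by rewrite /side; case: odd; rewrite ?subrr ?subr0; split; tauto.
have wrap k : (k <= N)%N -> exists l, [/\ (l < N)%N, a l = a k & b l = b k].
  move=> kN; have [->|ne] := eqVneq k N; first by exists 0%N; split=> //; lia.
  by exists k; split=> //; lia.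
have bdb k : (k <= N)%N -> cylinder_boundary (h (@vertex_point R V (b k))).
  by move=> /wrap[l [lN _ <-]]; rewrite vb//; apply/set_mem/corner => //; case: (side01 l).
have bda k : (k <= N)%N -> cylinder_boundary (h (@vertex_point R V (a k))).
  by move=> /wrap[l [lN <- _]]; rewrite va//; apply/set_mem/corner => //; case: (side01 l).
move=> e w /ring_hypergraphP[k kN [->|->]]; rewrite !inE => /orP[/orP[]|] /eqP->;
  first [exact: bda (ltnW kN)|exact: bda kN|exact: bdb (ltnW kN)|exact: bdb kN].
Qed.
End Ring.

(** * Pairs of vertices and codegrees *)

Section Codegree.
Variable V : finType.
Implicit Type H : {set {set V}}.

Definition tri H x y z := [set x; y; z]%SET \in H.

Definition codeg H x y := #|[pred z | tri H x y z]|.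

Definition shadow H : {set V * V} := [set p | [exists z, tri H p.1 p.2 z]]%SET.

Lemma triC H x y z : tri H x y z = tri H y x z.
Proof. by rewrite /tri [[set x; y]%SET]finset.setUC. Qed.

Lemma triCr H x y z : tri H x y z = tri H x z y.
Proof. by rewrite /tri -!finset.setUA [([set y] :|: _)%SET]finset.setUC. Qed.

Lemma tri_rev H x y z : tri H x y z = tri H z y x.
Proof. by rewrite triC triCr triC. Qed.

Lemma tri_neq H x y z : uniform3 H -> tri H x y z -> [&& x != y, x != z & y != z].
Proof.
move=> HU /HU; rewrite -finset.setUA cardsU1 cards2 !inE negb_or.
by case: (x == y); case: (x == z); case: (y == z).
Qed.

Lemma uniform3_tri H e : uniform3 H -> e \in H ->
  exists x y z, e = [set x; y; z]%SET.
Proof.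
move=> HU eH; have e3 := HU e eH.
have /card_gt2P[x [y [z [[xe ye ze] [xy yz zx]]]]] : (2 < #|e|)%N by rewrite e3.
exists x, y, z; apply/esym/eqP; rewrite eqEcard; apply/andP; split.
  by apply/fintype.subsetP => w; rewrite !inE => /orP[/orP[]|] /eqP->.
by rewrite e3 -finset.setUA cardsU1 cards2 !inE negb_or xy yz eq_sym zx.
Qed.

Lemma card_uniform3_le H : uniform3 H -> (#|H| <= #|V| ^ 3)%N.
Proof.
move=> HU; pose f (p : V * (V * V)) := [set p.1; p.2.1; p.2.2]%SET.
have -> : (#|V| ^ 3 = #|{: V * (V * V)}|)%N by rewrite !card_prod.
apply: leq_trans (leq_imset_card f _).
apply/subset_leq_card/fintype.subsetP => e /(uniform3_tri HU)[x [y [z ->]]].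
by apply/imsetP; exists (x, (y, z)).
Qed.

Lemma codeg_gt0 H x y z : tri H x y z -> (0 < codeg H x y)%N.
Proof. by move=> t; apply/card_gt0P; exists z. Qed.

(* Maximizing [#|H'| - d * #|shadow H'|] over the subhypergraphs: deleting the edges
   through a pair of codegree less than [d] would increase it. *)
Lemma exists_min_codegree H d : uniform3 H -> (d * #|V| ^ 2 < #|H|)%N ->
  exists H', [/\ H' \subset H, H' != finset.set0 &
    forall x y z, tri H' x y z -> (d <= codeg H' x y)%N].
Proof.
move=> HU dH.
(* The shift by [d * #|V| ^ 2] keeps the objective a natural number without truncating the
   subtraction. *)
pose f (H' : {set {set V}}) := (#|H'| + d * (#|V| ^ 2 - #|shadow H'|))%N.
have shV H' : (#|shadow H'| <= #|V| ^ 2)%N.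
  by rewrite -mulnn -card_prod; exact: max_card.
case: (@arg_maxnP _ H (fun H' : {set {set V}} => H' \subset H) f) => [//|K KH Kmax].
exists K; split=> //.
  apply: contraTneq (Kmax H (subxx H)) => ->; rewrite /f cards0.
  rewrite -ltnNge add0n; apply: (@leq_ltn_trans (d * #|V| ^ 2)%N).
    by rewrite leq_mul2l leq_subr orbT.
  exact: leq_trans dH (leq_addr _ _).
move=> x y z txyz; rewrite leqNgt; apply/negP => small.
pose bad := [set e in K | (x \in e) && (y \in e)]%SET.
pose L := (K :\: bad)%SET.
have xy : x != y by have /and3P[] := tri_neq (fun e eK => HU e (fintype.subsetP KH e eK)) txyz.
have badE : (#|bad| <= codeg K x y)%N.
  apply: leq_trans (leq_imset_card (fun w => [set x; y; w]%SET) [pred w | tri K x y w]).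
  apply/subset_leq_card/fintype.subsetP => e; rewrite inE => /and3P[eK xe ye].
  have e3 : #|e| = 3%N by apply: HU; exact: fintype.subsetP KH _ eK.
  have xye : [set x; y]%SET \subset e by apply/fintype.subsetP => w; rewrite !inE => /orP[] /eqP->.
  have : #|(e :\: [set x; y])%SET| = 1%N.
    by rewrite cardsD (finset.setIidPr xye) cards2 xy e3.
  move=> /eqP/cards1P[w wE].
  have eE : e = [set x; y; w]%SET by rewrite -wE -{1}(finset.setID e [set x; y]%SET) (finset.setIidPr xye).
  by apply/imsetP; exists w; rewrite // inE /tri -eE.
have LK : L \subset K by exact: finset.subsetDl.
have badK : bad \subset K by apply/fintype.subsetP => e; rewrite inE => /andP[].
have cL : #|K| = (#|bad| + #|L|)%N.
  by rewrite /L -(cardsID bad K) (finset.setIidPr badK).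
have shL : shadow L \proper shadow K.
  apply/fintype.properP; split.
    apply/fintype.subsetP => p; rewrite !inE => /existsP[w tw]; apply/existsP; exists w.
    exact: fintype.subsetP LK _ tw.
  exists (x, y); first by rewrite inE; apply/existsP; exists z.
  rewrite inE; apply/existsPn => w; rewrite /tri !inE /=; apply/negP.
  by rewrite !eqxx /= !orbT /= andbT => /andP[/negP].
have := Kmax L (fintype.subset_trans LK KH); rewrite /f cL.
have lt := proper_card shL; have leK := shV K.
have -> : (#|V| ^ 2 - #|shadow L| =
    (#|V| ^ 2 - #|shadow K|) + (#|shadow K| - #|shadow L|))%N by lia.
have : (d * 1 <= d * (#|shadow K| - #|shadow L|))%N by rewrite leq_mul2l subn_gt0 lt orbT.
rewrite mulnDr; lia.
Qed.
End Codegree.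

(** If every ratio failed, telescoping would give [rho ^+ m.-1 * t m < t 1], against the two bounds
    on [t]. *)
Lemma exists_small_ratio (R : realType) (t : nat -> R) (rho : R) m : (1 < m)%N -> 0 < rho ->
  1 <= t m -> t 1 <= rho ^+ m.-1 -> exists2 j, (2 <= j <= m)%N & t j.-1 <= rho * t j.
Proof.
move=> m1 rho0 tm t1; apply: contrapT => /forall2NP N.
have dec j : (2 <= j <= m)%N -> rho * t j < t j.-1.
  by move=> jm; case: (N j) => // /negP; rewrite -ltNge.
have iter i : (i < m)%N -> rho ^+ i * t i.+1 <= t 1%N.
  elim: i => [|i IH] im; first by rewrite mul1r.
  apply: le_trans (IH (ltnW im)); rewrite exprSr -mulrA ler_wpM2l ?exprn_ge0 ?(ltW rho0)//.
  by apply/ltW/(dec i.+2); rewrite /= im.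
case: m m1 {N} tm t1 dec iter => [|[|m]]// _ tm t1 dec iter.
have := iter m (ltnW (ltnSn _)); apply/negP; rewrite -ltNge.
apply: le_lt_trans t1 _; rewrite /= exprSr ltr_pM2l ?exprn_gt0//.
have lt : rho * t m.+2 < t m.+1 by apply: (dec m.+2); rewrite ltnSn.
by apply: le_lt_trans lt; rewrite ler_peMr ?(ltW rho0).
Qed.

(** * The normalized kernel on ordered pairs *)

Section Kernel.
Variables (R : realType) (V : finType) (H : {set {set V}}) (d : nat).
Hypothesis H_uniform : uniform3 H.
Hypothesis d_gt0 : (0 < d)%N.
Hypothesis codeg_ge : forall x y z, tri H x y z -> (d <= codeg H x y)%N.

Let cod x y : R := (codeg H x y)%:R.

(* [(a, b)] and [(c, e)] are adjacent when [a b e] and [b e c] are edges; the weight is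
   normalized so that [pair_weight] is an eigenvector for the eigenvalue [1]. *)
Definition pair_kernel (p q : V * V) : R :=
  (tri H p.1 p.2 q.2 && tri H p.2 q.2 q.1)%:R /
  (cod p.2 q.2 * (Num.sqrt (cod p.1 p.2) * Num.sqrt (cod q.1 q.2))).

Definition pair_weight (p : V * V) : R := Num.sqrt (cod p.1 p.2).

Definition pair_conf (p q : V * V) :=
  [|| p.1 == q.1, p.1 == q.2, p.2 == q.1 | p.2 == q.2].

Lemma codegC x y : codeg H x y = codeg H y x.
Proof. by apply: eq_card => z; rewrite !inE triC. Qed.

Lemma pair_kernel_ge0 p q : 0 <= pair_kernel p q.
Proof. by rewrite /pair_kernel divr_ge0 ?mulr_ge0 ?sqrtr_ge0. Qed.

Lemma pair_kernel_sym p q : pair_kernel p q = pair_kernel q p.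
Proof.
rewrite /pair_kernel /cod (codegC p.2) [Num.sqrt _ * _]mulrC; congr (_%:R / _).
by rewrite andbC tri_rev [in LHS](tri_rev _ p.1).
Qed.

Lemma pair_conf_sym : symmetric pair_conf.
Proof.
move=> p q; rewrite /pair_conf [q.1 == p.1]eq_sym [q.1 == p.2]eq_sym
  [q.2 == p.1]eq_sym [q.2 == p.2]eq_sym.
by congr (_ || _); rewrite orbCA.
Qed.

Lemma pair_weight_ge0 p : 0 <= pair_weight p.
Proof. exact: sqrtr_ge0. Qed.

Lemma pair_kernel_gt0 p q : 0 < pair_kernel p q ->
  tri H p.1 p.2 q.2 /\ tri H p.2 q.2 q.1.
Proof.
rewrite /pair_kernel; case: (boolP (tri H p.1 p.2 q.2)) => //= t1; last by rewrite mul0r ltxx.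
by case: (boolP (tri H p.2 q.2 q.1)) => //= t2; rewrite mul0r ltxx.
Qed.

Lemma pair_kernel_weight_gt0 p q : 0 < pair_kernel p q -> 0 < pair_weight p.
Proof. by move=> /pair_kernel_gt0[/codeg_gt0 t _]; rewrite sqrtr_gt0 ltr0n. Qed.

Lemma sum_tri x y : \sum_z (tri H x y z)%:R = cod x y.
Proof.
rewrite /cod /codeg -sum1_card natr_sum [RHS]big_mkcond.
by apply: eq_bigr => z _; rewrite inE; case: tri.
Qed.

(** After one more division by [pair_weight p] this is the law of a random step from [(a, b)]:
    choose [e] uniformly among the third vertices of edges on [a b], then [c] uniformly among those
    on [b e]. *)
Lemma kernel_weightE p q : pair_kernel p q * pair_weight q =
  (tri H p.1 p.2 q.2)%:R * ((tri H p.2 q.2 q.1)%:R / cod p.2 q.2) / pair_weight p.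
Proof.
rewrite /pair_kernel /pair_weight.
case: (boolP (tri H p.1 p.2 q.2)) => /= t1; last by rewrite !mul0r.
case: (boolP (tri H p.2 q.2 q.1)) => /= t2; last by rewrite !mul0r mulr0 mul0r.
have c1 : cod p.2 q.2 != 0 by rewrite pnatr_eq0 -lt0n (codeg_gt0 t2).
have c2 : Num.sqrt (cod p.1 p.2) != 0.
  by rewrite gt_eqF// sqrtr_gt0 ltr0n (codeg_gt0 t1).
have c3 : Num.sqrt (cod q.1 q.2) != 0.
  rewrite gt_eqF// sqrtr_gt0 ltr0n.
  by apply: (@codeg_gt0 _ _ _ _ p.2); rewrite tri_rev.
by field; rewrite c1 c2 c3.
Qed.

Lemma cod_div x : cod x.1 x.2 / pair_weight x = pair_weight x.
Proof.
rewrite /pair_weight; have [->|n0] := eqVneq (cod x.1 x.2) 0.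
  by rewrite mul0r sqrtr0.
by rewrite -[X in X / _]sqr_sqrtr ?ler0n// expr2 mulfK// gt_eqF// sqrtr_gt0 lt_neqAle eq_sym n0 ler0n.
Qed.

Lemma pair_kernel_weight p : \sum_q pair_kernel p q * pair_weight q = pair_weight p.
Proof.
under eq_bigr do rewrite kernel_weightE.
rewrite -(pair_bigA _ (fun c e => (tri H p.1 p.2 e)%:R * ((tri H p.2 e c)%:R / cod p.2 e) / pair_weight p)) /=.
rewrite exchange_big /= -[RHS]cod_div -sum_tri mulr_suml; apply: eq_bigr => e _.
rewrite -mulr_suml -mulr_sumr -mulr_suml sum_tri; congr (_ / _).
case: (boolP (tri H p.1 p.2 e)) => t; last by rewrite mul0r.
rewrite divff ?mulr1// pnatr_eq0 -lt0n; apply: (@codeg_gt0 _ _ _ _ p.1).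
by rewrite tri_rev triCr.
Qed.

Lemma inv_cod_le x y : (exists z, tri H x y z) -> (cod x y)^-1 <= d%:R^-1.
Proof.
move=> [z t]; rewrite lef_pV2 ?posrE ?ltr0n ?(codeg_gt0 t)// ler_nat; exact: codeg_ge t.
Qed.

Lemma inv_weight_le p z : tri H p.1 p.2 z -> (pair_weight p)^-1 <= d%:R^-1 * pair_weight p.
Proof.
move=> t; have wp : 0 < pair_weight p by rewrite sqrtr_gt0 ltr0n (codeg_gt0 t).
rewrite -(ler_pM2r wp) mulVf ?gt_eqF// -mulrA -expr2 sqr_sqrtr ?ler0n//.
rewrite mulrC ler_pdivlMr ?ltr0n// mul1r ler_nat; exact: codeg_ge t.
Qed.

(** Each of the two new vertices is uniform among at least [d] candidates, so it equals [w] with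
    probability at most [1 / d]. *)
Lemma pair_kernel_vertex p (w : V) :
  \sum_(q | (q.1 == w) || (q.2 == w)) pair_kernel p q * pair_weight q
    <= 2 / d%:R * pair_weight p.
Proof.
have t0 (q : V * V) : 0 <= pair_kernel p q * pair_weight q.
  by rewrite mulr_ge0 ?pair_kernel_ge0 ?pair_weight_ge0.
pose g c e : R := (tri H p.1 p.2 e)%:R * ((tri H p.2 e c)%:R / cod p.2 e) / pair_weight p.
apply: (@le_trans _ _ (\sum_e g w e + \sum_c g c w)).
  rewrite big_mkcond /=.
  apply: (@le_trans _ _ (\sum_(q : V * V) ((q.1 == w)%:R * g q.1 q.2 + (q.2 == w)%:R * g q.1 q.2))).
    apply: ler_sum => q _; have := t0 q; rewrite kernel_weightE -/(g q.1 q.2) => h.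
    by case: eqP => _; case: eqP => _ /=; rewrite ?mul0r ?mul1r ?addr0 ?add0r ?lerDl.
  rewrite big_split /= lerD//.
    rewrite -(pair_bigA _ (fun c e => (c == w)%:R * g c e)) /= (bigD1 w)//= [X in _ + X]big1 ?addr0.
      by apply: ler_sum => e _; rewrite eqxx mul1r.
    by move=> c /negbTE->; rewrite big1// => e _; rewrite mul0r.
  rewrite -(pair_bigA _ (fun c e => (e == w)%:R * g c e)) /=; apply: ler_sum => c _.
  by rewrite (bigD1 w)//= eqxx mul1r big1 ?addr0// => e /negbTE->; rewrite mul0r.
have -> : 2 / d%:R * pair_weight p = d%:R^-1 * pair_weight p + d%:R^-1 * pair_weight p.
  by field; rewrite pnatr_eq0 -lt0n.
have d0 : 0 <= d%:R^-1 :> R by rewrite invr_ge0.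
apply: lerD.
  rewrite -[X in _ <= _ * X]cod_div -sum_tri mulr_suml mulr_sumr; apply: ler_sum => e _.
  rewrite /g [X in _ <= X]mulrA; apply: ler_wpM2r; first by rewrite invr_ge0 pair_weight_ge0.
  case: (boolP (tri H p.1 p.2 e)) => t; rewrite ?mul0r ?mulr0// mul1r mulr1.
  case: (boolP (tri H p.2 e w)) => t'; rewrite ?mul0r// mul1r.
  by apply: inv_cod_le; exists w.
rewrite /g -mulr_suml -mulr_sumr -mulr_suml sum_tri.
case: (boolP (tri H p.1 p.2 w)) => t; last by rewrite !mul0r mulr_ge0 ?pair_weight_ge0.
rewrite mul1r divff ?mul1r; first exact: inv_weight_le t.
rewrite pnatr_eq0 -lt0n; apply: (@codeg_gt0 _ _ _ _ p.1); by rewrite tri_rev triCr.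
Qed.

Lemma pair_kernel_conf p r :
  \sum_(q | pair_conf q r) pair_kernel p q * pair_weight q <= 4 / d%:R * pair_weight p.
Proof.
have -> : 4 / d%:R * pair_weight p = 2 / d%:R * pair_weight p + 2 / d%:R * pair_weight p.
  by field; rewrite pnatr_eq0 -lt0n.
apply: le_trans (lerD (pair_kernel_vertex p r.1) (pair_kernel_vertex p r.2)).
rewrite [leLHS]big_mkcond [X in _ <= X + _]big_mkcond [X in _ <= _ + X]big_mkcond -big_split /=.
apply: ler_sum => q _.
have := mulr_ge0 (pair_kernel_ge0 p q) (pair_weight_ge0 q); rewrite /pair_conf.
set t := _ * _ => t0.
by case: (q.1 == r.1); case: (q.1 == r.2); case: (q.2 == r.1); case: (q.2 == r.2);
  rewrite /= ?addr0 ?add0r ?lerDl.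
Qed.

(** The walk lemma is applied with [delta = 4 / d], whence [256 = 64 * 4]. A closed walk of length
    [2 j <= 2 m] gives two triangles per step, hence at most [4 * m]. *)
Lemma exists_cylinder_cycle m (rho : R) : H != finset.set0 -> (1 < m)%N -> 0 < rho ->
  (#|V| ^ 2)%:R <= rho ^+ m.-1 -> 256 * m%:R ^+ 4 * rho <= d%:R ->
  exists C : {set {set V}}, [/\ C \subset H, cylinder_cycle R C,
    ~~ odd #|C| & (#|C| <= 4 * m)%N].
Proof.
move=> /set0Pn[e eH] m1 rho0 Vrho drho.
have [x0 [y0 [z0 eE]]] := uniform3_tri H_uniform eH.
have wpos : exists p, 0 < pair_weight p.
  exists (x0, y0); rewrite sqrtr_gt0 ltr0n; apply: (@codeg_gt0 _ _ _ _ z0).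
  by rewrite /tri -eE.
pose t := moment pair_kernel.
have tge1 j : 1 <= t j.
  exact: (moment_ge1 pair_kernel_ge0 pair_weight_ge0 pair_kernel_weight).
have [j jm ratio] : exists2 j, (2 <= j <= m)%N & t j.-1 <= rho * t j.
  apply: exists_small_ratio => //; apply: le_trans Vrho.
  rewrite -mulnn -card_prod.
  exact: (moment1_le pair_kernel_ge0 pair_kernel_sym pair_weight_ge0 pair_kernel_weight_gt0 pair_kernel_weight).
have dR : 0 < d%:R :> R by rewrite ltr0n.
have tj0 : 0 < t j by apply: lt_le_trans (tge1 j).
have d40 : 0 <= 4 / d%:R :> R by rewrite divr_ge0.
have := exists_conf_free_closed_walk pair_kernel_ge0 pair_kernel_sym pair_conf_sym
  d40 pair_weight_ge0 pair_kernel_weight_gt0 pair_kernel_weight pair_kernel_conf.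
move=> /(_ j)[||| x [s [ss ps ls cf]]].
- by lia.
- by [].
- rewrite -/t (_ : _ * _ = 256 * j%:R ^+ 4 * t j.-1 / d%:R); last by field; rewrite gt_eqF.
  rewrite ler_pdivrMr//; apply: (@le_trans _ _ (256 * m%:R ^+ 4 * (rho * t j))).
    apply: ler_pM; last exact: ratio.
    - by rewrite mulr_ge0 ?exprn_ge0.
    - exact: le_trans (tge1 _).
    - by rewrite ler_wpM2l// lerXn2r ?nnegrE// ler_nat; lia.
  by rewrite mulrA [X in _ <= X]mulrC ler_wpM2r// ltW.
pose N := (j + j)%N.
pose a k := (nth x (x :: s) k).1; pose b k := (nth x (x :: s) k).2.
have N2 : (2 < N)%N by rewrite /N; lia.
have Nev : ~~ odd N by rewrite /N addnn odd_double.
have nN : nth x (x :: s) N = x by rewrite /N -ss -last_nth.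
have aN : a N = a 0 by rewrite /a nN.
have bN : b N = b 0 by rewrite /b nN.
(* Adjacency of consecutive pairs supplies exactly the two triangles of the [k]-th quadrilateral. *)
have edge k : (k < N)%N -> tri H (a k) (b k) (b k.+1) /\ tri H (b k) (b k.+1) (a k.+1).
  move=> kN; apply: pair_kernel_gt0.
  by have /pathP := ps => /(_ x); apply; rewrite ss.
have ncf i i' : (i < N)%N -> (i' < N)%N -> i != i' ->
    ~~ pair_conf (nth x (x :: s) i) (nth x (x :: s) i').
  move=> iN i'N; rewrite neq_ltn => /orP[lt|lt]; first by apply: cf; rewrite lt.
  by rewrite pair_conf_sym; apply: cf; rewrite lt.
have ab i i' : (i < N)%N -> (i' < N)%N -> a i != b i'.
  (* Freedom from conflicts concerns distinct positions only; the two vertices of one pair differ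
     because they lie in a common edge. *)
  move=> iN i'N; have [<-|ne] := eqVneq i i'.
    by have [t1 _] := edge i iN; have /and3P[] := tri_neq H_uniform t1.
  by have := ncf i i' iN i'N ne; rewrite !negb_or => /and4P[].
have ainj i i' : (i < N)%N -> (i' < N)%N -> a i = a i' -> i = i'.
  move=> iN i'N E; apply/eqP; apply: contraT => ne.
  by have := ncf i i' iN i'N ne; rewrite !negb_or -/(a i) -/(a i') E eqxx.
have binj i i' : (i < N)%N -> (i' < N)%N -> b i = b i' -> i = i'.
  move=> iN i'N E; apply/eqP; apply: contraT => ne.
  have := ncf i i' iN i'N ne; rewrite !negb_or -/(b i) -/(b i') E eqxx.
  by rewrite !andbF.
exists (ring_hypergraph N a b); split.
- apply/fintype.subsetP => f /ring_hypergraphP[k kN [->|->]].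
  + by have [] := edge k kN.
  + by have [] := edge k kN.
- exact: ring_cylinder_cycle.
- by rewrite card_ring_hypergraph// oddD addbb.
- rewrite card_ring_hypergraph// /N; lia.
Qed.
End Kernel.

(** * Choice of parameters and the edge bound *)

Definition threshold (k : nat) : nat := ((257 * k.+1 ^ 4) ^ (k * k))%N.

Lemma threshold_powR (R : realType) (k n : nat) : (2 <= k)%N -> (threshold k <= n)%N ->
  256 * k.+1%:R ^+ 4 * n%:R `^ (2 / k%:R)
    <= (Num.truncn (n%:R `^ (2 / (k%:R - 1)) : R))%:R :> R.
Proof.
move=> k2 hn.
(* The exponents [2 / (k - 1)] and [2 / k] differ by [2 / (k (k - 1))]; multiplied by [k * k] this
   is at least [1], so [n >= c ^ (k * k)] makes the gain at least [c]. *)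
pose c : R := (257 * k.+1 ^ 4)%:R.
have kR : 2 <= k%:R :> R by rewrite ler_nat.
have c1 : 1 <= c by rewrite ler1n muln_gt0 expn_gt0.
have n1 : 1 <= n%:R :> R.
  by rewrite ler1n; apply: leq_trans hn; rewrite /threshold expn_gt0 muln_gt0 expn_gt0.
have cn : c <= n%:R `^ (2 / (k%:R * (k%:R - 1))).
  apply: (@le_trans _ _ ((c ^+ (k * k)) `^ (2 / (k%:R * (k%:R - 1))))).
    rewrite -powR_mulrn ?(le_trans ler01)// -powRrM -[X in X <= _]powRr1 ?(le_trans ler01)//.
    rewrite ler_powR//.
    have -> : (k * k)%:R * (2 / (k%:R * (k%:R - 1))) = 2 * (k%:R / (k%:R - 1)) :> R.
      by rewrite natrM; field; lra.
    suff : 1 <= k%:R / (k%:R - 1) :> R by lra.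
    by rewrite ler_pdivlMr; lra.
  rewrite ge0_ler_powR ?nnegrE ?exprn_ge0 ?(le_trans ler01 c1) ?(le_trans ler01 n1)//.
    by rewrite divr_ge0// mulr_ge0; lra.
  by rewrite /c -natrX ler_nat.
pose rho : R := n%:R `^ (2 / k%:R).
have rho1 : 1 <= rho.
  have := ler_powR n1 (_ : 0 <= 2 / k%:R); rewrite powRr0; apply.
  by rewrite divr_ge0.
have split : n%:R `^ (2 / (k%:R - 1)) = rho * n%:R `^ (2 / (k%:R * (k%:R - 1))) :> R.
  rewrite /rho -powRD; last by apply/implyP => _; rewrite gt_eqF//; lra.
  by congr (_ `^ _); field; lra.
have /andP[_ h] := truncn_itv (powR_ge0 (n%:R : R) (2 / (k%:R - 1))).
move: h; rewrite -natr1 split -/rho => h.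
have : rho * c <= rho * n%:R `^ (2 / (k%:R * (k%:R - 1))).
  by rewrite ler_wpM2l// (le_trans ler01).
rewrite {1}/c natrM natrX => h2.
(* The one unit by which [257] exceeds [256] pays for the truncation. *)
have : 1 * 1 <= k.+1%:R ^+ 4 * rho.
  by apply: ler_pM => //; rewrite exprn_ege1// ler1n.
move: h h2; set K := k.+1%:R ^+ 4; set T := (Num.truncn _)%:R; set X := rho * _ `^ _.
lra.
Qed.

Theorem theorem3p9 (R : realType) (k : nat) (hk : (2 <= k)%N) :
  exists eps : nat -> R,
    (eps n @[n --> \oo] --> (0 : R)) /\
    forall (n : nat) (V : finType) (H : {set {set V}}),
      #|V| = n ->
      uniform3 H ->
      ~ (exists C : {set {set V}},
           [/\ C \subset H, torus_like_cycle R C & (#|C| <= 6 * k)%N]) ->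
      #|H|%:R <= n%:R `^ (2 + 2 / (k%:R - 1) + eps n) :> R.
Proof.
(* Below the threshold the error term [1] raises the exponent to at least [3], and the trivial bound
   [n ^ 3] suffices. *)
exists (fun n => (n < threshold k)%N%:R); split.
  apply: cvg_near_cst; exists (threshold k) => // n /= hn.
  by rewrite ltnNge hn.
move=> n V H cV HU noC.
have kR : 2 <= k%:R :> R by rewrite ler_nat.
have e0 : 0 <= 2 / (k%:R - 1) :> R by rewrite divr_ge0//; lra.
have [small|large] := ltnP n (threshold k).
  have cH := card_uniform3_le HU; rewrite cV in cH.
  have [n0|n0] := posnP n; first by move: cH; rewrite n0 leqn0 => /eqP->; exact: powR_ge0.
  apply: (@le_trans _ _ (n ^ 3)%:R); first by rewrite ler_nat.
  rewrite natrX -powR_mulrn// ler_powR ?ler1n//.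
  by rewrite [true%:R](_ : _ = 1)//; lra.
rewrite addr0 leNgt; apply/negP => big.
have n0 : (0 < n)%N by apply: leq_trans large; rewrite expn_gt0 muln_gt0 expn_gt0.
pose d := Num.truncn (n%:R `^ (2 / (k%:R - 1)) : R).
have dbig := @threshold_powR R k n hk large; rewrite -/d in dbig.
have rho0 : 0 < n%:R `^ (2 / k%:R) :> R by apply: powR_gt0; rewrite ltr0n.
have d0 : (0 < d)%N.
  rewrite -(ltr0n R); apply: lt_le_trans dbig.
  by rewrite !mulr_gt0// exprn_gt0.
have dH : (d * #|V| ^ 2 < #|H|)%N.
  rewrite -(ltr_nat R) cV natrM natrX; apply: le_lt_trans big.
  rewrite powRD; last by rewrite pnatr_eq0 -lt0n n0 implybT.
  rewrite powR_mulrn// mulrC ler_wpM2l ?exprn_ge0//.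
  by have /andP[] := truncn_itv (powR_ge0 (n%:R : R) (2 / (k%:R - 1))).
have [H' [H'H H'0 H'd]] := exists_min_codegree HU dH.
have H'U : uniform3 H' by move=> e eH'; apply: HU; exact: fintype.subsetP H'H e eH'.
(* With [m = k + 1] and [rho = n ^ (2 / k)], the power [rho ^ (m - 1)] is exactly [n ^ 2]. *)
have [||||C [CH' Ccyl Cev Cle]] :=
  @exists_cylinder_cycle R V H' d H'U d0 H'd k.+1 (n%:R `^ (2 / k%:R)) H'0.
- by rewrite ltnS; exact: leq_trans hk.
- exact: rho0.
- rewrite cV natrX -powR_mulrn ?powR_ge0// -powRrM divfK; last by rewrite gt_eqF//; lra.
  by rewrite powR_mulrn.
- exact: dbig.
apply: noC; exists C; split.
- exact: fintype.subset_trans CH' H'H.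
- by left.
(* [4 * (k + 1) <= 6 * k] holds exactly when [k >= 2]. *)
- by apply: leq_trans Cle _; lia.
Qed.
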